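(* Let $M$ be a connected closed oriented torsion-free smooth hypersurface embedded in a Weitzenböck $(n+1)$-manifold $\tilde M$, such that the smooth $(1,1)$-tensor field $HI+2W^{\mathsf a}$ on $M$ is divergence-free. Then the following two are equivalent. (a) The image of the Gauss map $g\colon M\to\mathbb{S}^n$ is contained in a closed hemisphere. (b) The image of the Gauss map $g\colon M\to\mathbb{S}^n$ is contained in an equator.
   Context: A Weitzenböck $(n+1)$-manifold $\tilde M$ is a smooth $(n+1)$-manifold with a fixed global smooth frame $(\tilde E_1,\dots,\tilde E_{n+1})$, equipped with the orientation and the metric making this frame oriented orthonormal, and with the metric-compatible flat connection $\tilde\nabla$ determined by $\tilde\nabla\tilde E_i=0$ for all $i$. An oriented smooth hypersurface $M\subset\tilde M$ carries the restricted metric $\langle\cdot,\cdot\rangle$ and the projected metric-compatible connection $\nabla_XY=(\tilde\nabla_XY)^\top$ (tangential part). $M$ is torsion-free if $T(X,Y)=\nabla_XY-\nabla_YX-[X,Y]$ vanishes everywhere. $N$ is the unit normal vector field along $M$ such that a frame $(E_1,\dots,E_n)$ of $M$ is oriented iff $(N,E_1,\dots,E_n)$ is oriented in $\tilde M$. The Weingarten map $W$ is the $(1,1)$-tensor field on $M$ with $\langle WX,Y\rangle=\langle N,\tilde\nabla_XY\rangle$ (not necessarily symmetric); $H=\operatorname{tr}W$, $W^{\mathsf a}=\frac12(W-W^{\mathsf t})$ with $W^{\mathsf t}$ the adjoint, and $I$ is the identity operator. A smooth $(1,1)$-tensor field $A$ on $M$ is divergence-free if $\operatorname{div}A=\sum_i(\nabla_{E_i}A)E_i=0$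 (for local orthonormal frames $(E_i)$ of $M$). Gauss map: writing $N=\sum_iN^i\tilde E_i$, $g=(N^1,\dots,N^{n+1})\colon M\to\mathbb{S}^n$. A closed hemisphere is a set $\{x\in\mathbb{S}^n:\langle V,x\rangle\le0\}$ and an equator is a set $\{x\in\mathbb{S}^n:\langle V,x\rangle=0\}$, for some $V\in\mathbb{S}^n$. *)

(* Defs.v *)
From HB Require Import structures.
From mathcomp Require Import all_boot all_order all_algebra.
From mathcomp Require Import all_classical all_reals all_analysis.

Set Implicit Arguments.
Unset Strict Implicit.
Unset Printing Implicit Defensive.

Import Order.TTheory GRing.Theory Num.Theory.
Import numFieldNormedType.Exports.
Local Open Scope classical_set_scope.
Local Open Scope ring_scope.

Definition dot (R : realType) (d : nat) (u v : 'rV[R]_d) : R :=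
  \sum_i u ord0 i * v ord0 i.

(* C^k and C^oo on an open set U. *)
Fixpoint Ck (R : realType) (d : nat) (V : normedModType R) (k : nat)
    (U : set 'rV[R]_d) (f : 'rV[R]_d -> V) : Prop :=
  match k with
  | 0%N => forall x, U x -> {for x, continuous f}
  | k'.+1 => (forall x, U x -> differentiable f x) /\
             forall v : 'rV[R]_d, Ck k' U (fun x => 'D_v f x)
  end.

Definition Coo (R : realType) (d : nat) (V : normedModType R)
    (U : set 'rV[R]_d) (f : 'rV[R]_d -> V) : Prop := forall k, Ck k U f.

(* Hausdorff second countable smooth d-manifolds without boundary.  The atlas
   is given as a family of charts indexed by the points, the chart of index c
   being defined around c.  This is no restriction on the smooth structure:
   choose one chart of a given atlas around every point.
   [chart c] and [chinv c] are only relevant on [chdom c] and on its image. *)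
Record smoothManifold (R : realType) (d : nat) := SmoothManifold {
  msort :> topologicalType;
  chdom : msort -> set msort;
  chart : msort -> msort -> 'rV[R]_d;
  chinv : msort -> 'rV[R]_d -> msort;
  mfd_hausdorff : hausdorff_space msort;
  mfd_second_countable : @second_countable msort;
  chdom_center : forall c, chdom c c;
  chdom_open : forall c, open (chdom c);
  chart_open : forall c, open (chart c @` chdom c);
  chartK : forall c p, chdom c p -> chinv c (chart c p) = p;
  chart_continuous : forall c p, chdom c p -> {for p, continuous (chart c)};
  chinv_continuous : forall c x,
    (chart c @` chdom c) x -> {for x, continuous (chinv c)};
  transition_smooth : forall c e,
    Coo (chart c @` (chdom c `&` chdom e)) (chart e \o chinv c) }.

Definition smooth_on (R : realType) (d : nat) (M : smoothManifold R d)
    (V : normedModType R) (U : set M) (f : M -> V) : Prop :=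
  forall c : M, Coo (chart c @` (chdom c `&` U)) (f \o chinv c).

Definition smooth_map (R : realType) (d e : nat) (M : smoothManifold R d)
    (M' : smoothManifold R e) (F : M -> M') : Prop :=
  continuous F /\
  forall (c : M) (c' : M'),
    Coo (chart c @` (chdom c `&` F @^-1` chdom c')) (chart c' \o F \o chinv c).

(* The tangent space at p is 'rV[R]_d: a tangent vector is represented by its
   components in the coordinate basis of the chart of index p.  So a vector
   field is a map M -> 'rV[R]_d, and a (1,1)-tensor field is a map M -> 'M[R]_d
   acting on row vectors, v |-> v *m A p. *)

(* Derivative at p of a vector-valued function along the tangent vector v. *)
Definition vder (R : realType) (d : nat) (M : smoothManifold R d)
    (V : normedModType R) (f : M -> V) (p : M) (v : 'rV[R]_d) : V :=
  'D_v (f \o chinv p) (chart p p).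

(* Differential T_p M -> T_(F p) M' of a map between manifolds. *)
Definition dmap (R : realType) (d e : nat) (M : smoothManifold R d)
    (M' : smoothManifold R e) (F : M -> M') (p : M) (v : 'rV[R]_d) : 'rV[R]_e :=
  vder (chart (F p) \o F) p v.

(* Components of the vector field X in the coordinate basis of the chart of
   index c; relevant on [chdom c]. *)
Definition field_in_chart (R : realType) (d : nat) (M : smoothManifold R d)
    (X : M -> 'rV[R]_d) (c : M) : M -> 'rV[R]_d :=
  fun x => vder (chart c) x (X x).

Definition smooth_field (R : realType) (d : nat) (M : smoothManifold R d)
    (U : set M) (X : M -> 'rV[R]_d) : Prop :=
  forall c : M, smooth_on (U `&` chdom c) (field_in_chart X c).

(* [X,Y]^i = X^j d_j Y^i - Y^j d_j X^i at p, in the chart of index p. *)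
Definition bracket (R : realType) (d : nat) (M : smoothManifold R d)
    (X Y : M -> 'rV[R]_d) (p : M) : 'rV[R]_d :=
  vder (field_in_chart Y p) p (X p) - vder (field_in_chart X p) p (Y p).

(* An orientation singles out, among the bases of each tangent space (the rows
   of an invertible matrix), one of the two classes for the relation "the
   change of basis has positive determinant", and is locally represented by
   smooth frames. *)
Record orientation (R : realType) (d : nat) (M : smoothManifold R d) :=
  Orientation {
  oriented : M -> set 'M[R]_d;
  oriented_basis : forall p B, oriented p B -> B \in unitmx;
  oriented_class : forall p B B', oriented p B -> B' \in unitmx ->
    (oriented p B' <-> 0 < \det (B' *m invmx B));
  oriented_smooth : forall p, exists U : set M, exists F : M -> 'M[R]_d,
    [/\ open U, U p, forall i, smooth_field U (fun x => row i (F x)) &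
        forall x, U x -> oriented x (F x)] }.

Record weitzenbock (R : realType) (d : nat) := Weitzenbock {
  wmfd :> smoothManifold R d;
  wframe : 'I_d -> wmfd -> 'rV[R]_d;
  wframe_smooth : forall i, smooth_field setT (wframe i);
  wframe_basis : forall q, \matrix_i wframe i q \in unitmx }.

(* Components of a tangent vector at q in the global frame. *)
Definition fcomp (R : realType) (d : nat) (Mt : weitzenbock R d) (q : Mt)
    (w : 'rV[R]_d) : 'rV[R]_d :=
  w *m invmx (\matrix_i wframe i q).

(* The metric making the global frame orthonormal. *)
Definition wmetric (R : realType) (d : nat) (Mt : weitzenbock R d) (q : Mt)
    (u v : 'rV[R]_d) : R := dot (fcomp q u) (fcomp q v).

(* The orientation making the global frame oriented, on the rows of B. *)
Definition woriented (R : realType) (d : nat) (Mt : weitzenbock R d) (q : Mt)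
    (B : 'M[R]_d) : Prop :=
  0 < \det (B *m invmx (\matrix_i wframe i q)).

(* The flat connection determined by parallelism of the global frame, acting
   on vector fields along a map F : P -> Mt: if Y = sum_i Y^i E_i(F), then
   its derivative along v is sum_i v(Y^i) E_i(F).  The case F = id is the
   connection of Mt. *)
Definition wcov (R : realType) (e d : nat) (P : smoothManifold R e)
    (Mt : weitzenbock R d) (F : P -> Mt) (Y : P -> 'rV[R]_d) (p : P)
    (v : 'rV[R]_e) : 'rV[R]_d :=
  \sum_i vder (fun x => fcomp (F x) (Y x) ord0 i) p v *: wframe i (F p).

Definition smooth_along (R : realType) (e d : nat) (P : smoothManifold R e)
    (Mt : weitzenbock R d) (F : P -> Mt) (Y : P -> 'rV[R]_d) : Prop :=
  smooth_on setT (fun x => fcomp (F x) (Y x)).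

Definition smooth_embedding (R : realType) (e d : nat) (M : smoothManifold R e)
    (M' : smoothManifold R d) (F : M -> M') : Prop :=
  [/\ smooth_map F, forall p, injective (dmap F p), injective F &
      forall U : set M, open U ->
        exists2 O : set M', open O & U = F @^-1` O].

Section Hypersurface.
Variables (R : realType) (n : nat) (M : smoothManifold R n).
Variables (Mt : weitzenbock R n.+1) (iota : M -> Mt).

Implicit Types (p : M) (u v : 'rV[R]_n) (X Y : M -> 'rV[R]_n).

Definition induced_metric p u v : R :=
  wmetric (iota p) (dmap iota p u) (dmap iota p v).

(* The tangential part of a tangent vector w of Mt at iota p, as an element of
   the tangent space of M at p: the unique z such that w - d iota (z) is
   orthogonal to the image of d iota. *)
Definition tangential p (w : 'rV[R]_n.+1) : 'rV[R]_n :=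
  xget 0 [set z : 'rV[R]_n |
    forall u, wmetric (iota p) (w - dmap iota p z) (dmap iota p u) = 0].

(* The derivative in Mt of the vector field Y of M along v. *)
Definition ambient_cov Y p v : 'rV[R]_n.+1 :=
  wcov iota (fun x => dmap iota x (Y x)) p v.

Definition nabla Y p v : 'rV[R]_n := tangential p (ambient_cov Y p v).

(* Tensor identities are tested on vector fields over open subsets of M. *)
Definition torsion_free : Prop :=
  forall (U : set M) X Y, open U -> smooth_field U X -> smooth_field U Y ->
    forall p, U p -> nabla Y p (X p) - nabla X p (Y p) - bracket X Y p = 0.

Definition is_unit_normal (o : orientation M) (N : M -> 'rV[R]_n.+1) : Prop :=
  smooth_along iota N /\
  forall p,
    [/\ wmetric (iota p) (N p) (N p) = 1,
        forall v, wmetric (iota p) (N p) (dmap iota p v) = 0 &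
        forall B : 'M[R]_n, B \in unitmx ->
          (oriented o p B <->
           woriented (iota p)
             (col_mx (N p) (\matrix_i dmap iota p (row i B))))].

Definition is_weingarten (N : M -> 'rV[R]_n.+1) (W : M -> 'M[R]_n) : Prop :=
  forall (U : set M) Y, open U -> smooth_field U Y -> forall p v, U p ->
    induced_metric p (v *m W p) (Y p) =
    wmetric (iota p) (N p) (ambient_cov Y p v).

Definition adjoint (A : M -> 'M[R]_n) p : 'M[R]_n :=
  xget 0 [set B : 'M[R]_n | forall u v,
    induced_metric p (u *m B) v = induced_metric p u (v *m A p)].

Definition antisym_part (A : M -> 'M[R]_n) p : 'M[R]_n :=
  2^-1 *: (A p - adjoint A p).

(* (nabla_v A) Y = nabla_v (A Y) - A (nabla_v Y) *)
Definition nabla_tensor (A : M -> 'M[R]_n) Y p v : 'rV[R]_n :=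
  nabla (fun x => Y x *m A x) p v - nabla Y p v *m A p.

Definition orthonormal_frame (U : set M) (E : 'I_n -> M -> 'rV[R]_n) : Prop :=
  (forall i, smooth_field U (E i)) /\
  forall p, U p -> forall i j,
    induced_metric p (E i p) (E j p) = (i == j)%:R.

Definition divergence_free (A : M -> 'M[R]_n) : Prop :=
  forall (U : set M) (E : 'I_n -> M -> 'rV[R]_n),
    open U -> orthonormal_frame U E ->
    forall p, U p -> \sum_i nabla_tensor A (E i) p (E i p) = 0.

Definition gauss_map (N : M -> 'rV[R]_n.+1) p : 'rV[R]_n.+1 :=
  fcomp (iota p) (N p).

End Hypersurface.

Definition sphere (R : realType) (d : nat) : set 'rV[R]_d :=
  [set x | dot x x = 1].

Definition closed_hemisphere (R : realType) (d : nat) (V : 'rV[R]_d) :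
    set 'rV[R]_d :=
  @sphere R d `&` [set x | dot V x <= 0].

Definition equator (R : realType) (d : nat) (V : 'rV[R]_d) : set 'rV[R]_d :=
  @sphere R d `&` [set x | dot V x = 0].

(* Main.v *)
Require Import Defs.
From HB Require Import structures.
From mathcomp Require Import all_boot all_order all_algebra.
From mathcomp Require Import all_classical all_reals all_analysis.
From mathcomp Require Import ring lra.
Set Implicit Arguments.
Unset Strict Implicit.
Unset Printing Implicit Defensive.
Import Order.TTheory GRing.Theory Num.Theory.
Import numFieldNormedType.Exports.
Local Open Scope classical_set_scope.
Local Open Scope ring_scope.

(** In the parallel frame of the ambient manifold the differential of [iota] is a
    1-form [theta] on [M] with values in a Euclidean space, and the unit normal is the
    Gauss map.  For a fixed vector V consider the height $u = V . g$ of the Gauss map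
    $g$, and the Laplacian $L f = \sum_i e_i (e_i f) - (nabla_{e_i} e_i) f$ for a local
    orthonormal frame ([gram_schmidt]).  Since $d g = - theta \o W$, one finds

      $L u = - V . theta (div W) - u |W|^2$.

    Flatness of the ambient connection and the vanishing of the torsion of $M$ give the
    Codazzi equation ([codazzi]), which contracts to $div W^t = grad H$.  Therefore
    $div (H I + 2 W^a) = div (H I + W - W^t) = div W$ ([divergence_algebra]), and the
    hypothesis says $div W = 0$; that is, $L u = - u |W|^2$ ([height_laplacian]).

    If the image of $g$ lies in the closed hemisphere of V, then $u <= 0$ and
    $L u >= 0$.  The function $u$ attains its maximum on the compact $M$, and the strong
    maximum principle ([strong_maximum]) together with connectedness shows that $u$ is
    constant ([height_constant]).  If the constant is 0, the image of $g$ is in the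
    equator of V.  Otherwise $L u = 0$ forces $W = 0$, all the heights
    $V' . g$ satisfy $L (V' . g) = 0$ and are constant for the same reason; for V' a unit
    tangent vector at some point the constant is 0, so the image of $g$ is in the equator
    of V'.  The other implication is immediate. *)

(** * Dot product and orthonormal families *)

Section Dot.
Variables (R : realType) (d : nat).
Implicit Types u v w : 'rV[R]_d.

Lemma dotC u v : dot u v = dot v u.
Proof. by apply: eq_bigr => i _; rewrite mulrC. Qed.

Lemma dotDl u v w : dot (u + v) w = dot u w + dot v w.
Proof. by rewrite /dot -big_split; apply: eq_bigr => i _; rewrite mxE mulrDl. Qed.

Lemma dotZl a u v : dot (a *: u) v = a * dot u v.
Proof. by rewrite /dot mulr_sumr; apply: eq_bigr => i _; rewrite mxE mulrA. Qed.

Lemma dot0l v : dot 0 v = 0.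
Proof. by rewrite -(scale0r (0 : 'rV[R]_d)) dotZl mul0r. Qed.

Lemma dotNl u v : dot (- u) v = - dot u v.
Proof. by rewrite -scaleN1r dotZl mulN1r. Qed.

Lemma dotBl u v w : dot (u - v) w = dot u w - dot v w.
Proof. by rewrite dotDl dotNl. Qed.

Lemma dot_suml (I : Type) (r : seq I) (f : I -> 'rV[R]_d) v :
  dot (\sum_(i <- r) f i) v = \sum_(i <- r) dot (f i) v.
Proof.
elim: r => [|i r IH]; first by rewrite !big_nil dot0l.
by rewrite !big_cons dotDl IH.
Qed.

Lemma dotDr u v w : dot w (u + v) = dot w u + dot w v.
Proof. by rewrite dotC dotDl !(dotC w). Qed.

Lemma dotZr a u v : dot v (a *: u) = a * dot v u.
Proof. by rewrite dotC dotZl (dotC v). Qed.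

Lemma dot0r v : dot v 0 = 0.
Proof. by rewrite dotC dot0l. Qed.

Lemma dotNr u v : dot v (- u) = - dot v u.
Proof. by rewrite dotC dotNl (dotC v). Qed.

Lemma dot_sumr (I : Type) (r : seq I) (f : I -> 'rV[R]_d) v :
  dot v (\sum_(i <- r) f i) = \sum_(i <- r) dot v (f i).
Proof. by rewrite dotC dot_suml; apply: eq_bigr => i _; rewrite dotC. Qed.

Lemma dot_ge0 u : 0 <= dot u u.
Proof. by apply: sumr_ge0 => i _; rewrite -expr2 sqr_ge0. Qed.

Lemma dot_eq0 u : dot u u = 0 -> u = 0.
Proof.
move=> /eqP; rewrite psumr_eq0 => [|i _]; last by rewrite -expr2 sqr_ge0.
move=> /allP h; apply/rowP => i; rewrite mxE; apply/eqP.
by have /implyP := h i (mem_index_enum i); rewrite mulf_eq0 orbb; apply.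
Qed.

Lemma dot_gt0 u : u != 0 -> 0 < dot u u.
Proof.
move=> u0; rewrite lt_def dot_ge0 andbT; apply: contraNneq u0 => /dot_eq0 ->.
by rewrite eqxx.
Qed.

Lemma dot_mx m k (A : 'M[R]_(m, d)) (B : 'M[R]_(k, d)) i j :
  (A *m B^T) i j = dot (row i A) (row j B).
Proof. by rewrite mxE; apply: eq_bigr => l _; rewrite !mxE. Qed.

End Dot.

Lemma sum_mul_delta (R : pzRingType) (n : nat) (F : 'I_n -> R) k :
  \sum_j F j * (j == k)%:R = F k.
Proof.
by rewrite (bigD1 k)//= eqxx mulr1 big1 ?addr0// => j /negPf ->; rewrite mulr0.
Qed.

Lemma gram_schmidt_orth (R : realType) (m k : nat) (x : 'rV[R]_m) (e : 'I_k -> 'rV[R]_m) j :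
  (forall i l, dot (e i) (e l) = (i == l)%:R) ->
  dot (x + \sum_i - dot x (e i) *: e i) (e j) = 0.
Proof.
move=> oe; rewrite dotDl dot_suml (bigD1 j)//= dotZl oe eqxx mulr1 big1 ?addr0 ?subrr//.
by move=> i /negPf ij; rewrite dotZl oe ij mulr0.
Qed.

(** Orthonormality for the inner product pulled back by [T] exhibits a right inverse
    of the square matrix of the [e i]; it is also a left inverse, which is the
    expansion formula. *)
Lemma frame_expand (R : realType) (n m : nat) (T : 'M[R]_(n, m)) (e : 'I_n -> 'rV[R]_n) :
  (forall i j, dot (e i *m T) (e j *m T) = (i == j)%:R) ->
  forall v, v = \sum_i dot (v *m T) (e i *m T) *: e i.
Proof.
move=> oe v; pose E := \matrix_i e i.
have EE : E *m (T *m (E *m T)^T) = 1%:M.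
  apply/matrixP => i j; rewrite mulmxA dot_mx !row_mul !rowK oe mxE.
  by case: eqP.
rewrite -[LHS]mulmx1 -(mulmx1C EE) mulmxA mulmx_sum_row.
by apply: eq_bigr => i _; rewrite rowK mulmxA dot_mx row_id row_mul rowK.
Qed.

(** [frame_expand] for the standard inner product and the family [nu], [t 0], ...,
    which has as many vectors as the dimension. *)
Lemma frame_complete (R : realType) (n : nat) (t : 'I_n -> 'rV[R]_n.+1) (nu : 'rV[R]_n.+1) :
  (forall i j, dot (t i) (t j) = (i == j)%:R) ->
  (forall i, dot nu (t i) = 0) -> dot nu nu = 1 ->
  forall w, w = \sum_i dot w (t i) *: t i + dot w nu *: nu.
Proof.
move=> tt nt nn w.
pose e (i : 'I_n.+1) : 'rV[R]_n.+1 := if unlift ord0 i is Some j then t j else nu.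
have oe i j : dot (e i *m 1%:M) (e j *m 1%:M) = (i == j)%:R.
  rewrite !mulmx1 /e.
  case: unliftP => [i' ->|->]; case: unliftP => [j' ->|->].
  - by rewrite tt (inj_eq lift_inj).
  - by rewrite dotC nt eq_sym (negPf (neq_lift _ _)).
  - by rewrite nt (negPf (neq_lift _ _)).
  - by rewrite eqxx.
rewrite [LHS](frame_expand oe) big_ord_recl addrC; congr (_ + _).
  by apply: eq_bigr => i _; rewrite !mulmx1 /e liftK.
by rewrite !mulmx1 /e unlift_none.
Qed.

(** This is what makes [\sum_i dot x (t i) *: t i] the orthogonal projection of [x]
    on the span of an orthonormal family [t]; it yields tangential parts below. *)
Lemma frame_project (R : realType) (n m : nat) (t : 'I_n -> 'rV[R]_m) (x y : 'rV[R]_m) :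
  y = \sum_i dot y (t i) *: t i ->
  dot x y - dot (\sum_i dot x (t i) *: t i) y = 0.
Proof.
move=> Ey; rewrite {1}Ey dot_sumr dot_suml -sumrB big1// => i _.
by rewrite dotZr dotZl (dotC (t i)) mulrC subrr.
Qed.

(** * Maps of class C^k on open subsets of a Euclidean space *)

Lemma near_eq_differentiable (R : realType) (V W : normedModType R)
    (f g : V -> W) (x : V) :
  (\forall y \near x, f y = g y) -> differentiable f x -> differentiable g x.
Proof.
move=> fg df.
have H : g \o shift x = cst (g x) + 'd f x +o_ 0 id.
  apply/eqaddoP => e e0.
  have /eqaddoP /(_ e e0) := diff_locally df.
  have fg0 : \forall h \near (0 : V), f (h + x) = g (h + x).
    by move: fg; rewrite (near_shift 0) subr0.
  have gx : f x = g x by apply: nbhs_singleton fg.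
  apply: filter_app; near=> h.
  rewrite /= !fctE /= -gx.
  by have -> : f (h + x) = g (h + x) by near: h.
have dfc : continuous ('d f x) by exact: diff_continuous.
have dE := diff_unique dfc H.
by apply/diff_locallyP; rewrite dE.
Unshelve. all: by end_near. Qed.

Section Calc.
Variables (R : realType) (d : nat).
Implicit Types (U : set 'rV[R]_d) (V : normedModType R).

Lemma Ck_congr V k U (f g : 'rV[R]_d -> V) :
  open U -> (forall x, U x -> f x = g x) -> Ck k U f -> Ck k U g.
Proof.
move=> oU; elim: k f g => [|k IH] f g fg /=.
  move=> cf x Ux.
  have nfg : {near x, f =1 g}.
    by have : nbhs x U by [exact: open_nbhs_nbhs]; apply: filterS => y /fg.
  have fc : f @ x --> f x := cf _ Ux.
  suff : g @ x --> g x by [].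
  rewrite -(fg _ Ux); apply: cvg_trans fc; exact: (near_eq_cvg nfg).
move=> [df cf]; split=> [x Ux|v].
  apply: near_eq_differentiable (df _ Ux).
  by have : nbhs x U by [exact: open_nbhs_nbhs]; apply: filterS => y /fg.
apply: IH (cf v) => x Ux; apply: near_eq_derive.
by have : nbhs x U by [exact: open_nbhs_nbhs]; apply: filterS => y /fg.
Qed.

Lemma CkS V k U (f : 'rV[R]_d -> V) : Ck k.+1 U f -> Ck k U f.
Proof.
elim: k f => [|k IH] f; first by move=> [df _] x /df /differentiable_continuous.
by move=> [df cf]; split => // v; apply: IH; exact: cf.
Qed.

Lemma Ck_sub V k U U' (f : 'rV[R]_d -> V) : U' `<=` U -> Ck k U f -> Ck k U' f.
Proof.
move=> sU; elim: k f => [|k IH] f /=; first by move=> h x /sU; exact: h.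
by move=> [df cf]; split=> [x /sU|v]; [exact: df|exact: IH].
Qed.

Lemma Ck_local V k U (f : 'rV[R]_d -> V) :
  (forall x, U x -> exists2 U', U' x & Ck k U' f) -> Ck k U f.
Proof.
elim: k f => [|k IH] f /=; first by move=> h x /h [U' U'x]; exact.
move=> h; split=> [x /h [U' U'x [+ _]]|v]; first exact.
by apply: IH => x /h [U' U'x [_ +]] => /(_ v) ?; exists U'.
Qed.

Lemma Ck_cst V k U (a : V) : Ck k U (fun=> a).
Proof.
elim: k a => [|k IH] a /=; first by move=> x _; exact: cst_continuous.
split=> [x _|v]; first exact: differentiable_cst.
have -> : (fun x => 'D_v (fun=> a) x) = (fun=> 0) :> ('rV[R]_d -> V).
  by apply/funext => x; exact: derive_cst.
exact: IH.
Qed.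

Lemma CkD V k U (f g : 'rV[R]_d -> V) : open U ->
  Ck k U f -> Ck k U g -> Ck k U (fun x => f x + g x).
Proof.
move=> oU; elim: k f g => [|k IH] f g /=.
  by move=> cf cg x Ux; apply: continuousD; [exact: cf|exact: cg].
move=> [df cf] [dg cg]; split=> [x Ux|v].
  by apply: differentiableD; [exact: df|exact: dg].
apply: (@Ck_congr _ _ _ (fun x => 'D_v f x + 'D_v g x)) => //;
  last by apply: IH; [exact: cf|exact: cg].
move=> x Ux; rewrite -deriveD//; apply: diff_derivable; [exact: df|exact: dg].
Qed.

Lemma Ck_sum V k U (I : Type) (r : seq I) (f : I -> 'rV[R]_d -> V) : open U ->
  (forall i, Ck k U (f i)) -> Ck k U (fun x => \sum_(i <- r) f i x).
Proof.
move=> oU h; elim: r => [|i r IH].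
  apply: (@Ck_congr _ _ _ (fun=> 0)) => //; last exact: Ck_cst.
  by move=> x _; rewrite big_nil.
apply: (@Ck_congr _ _ _ (fun x => f i x + \sum_(i <- r) f i x)) => //; last exact: CkD.
by move=> x _; rewrite big_cons.
Qed.

Lemma CkM k U (f g : 'rV[R]_d -> R) : open U ->
  Ck k U f -> Ck k U g -> Ck k U (fun x => f x * g x).
Proof.
move=> oU; elim: k f g => [|k IH] f g.
  by move=> cf cg x Ux; apply: continuousM; [exact: cf|exact: cg].
move=> cf cg; have cf' := CkS cf; have cg' := CkS cg.
case: cf cg => [df cf] [dg cg]; split=> [x Ux|v].
  by apply: differentiableM; [exact: df|exact: dg].
apply: (@Ck_congr _ _ _ (fun x => f x * 'D_v g x + g x * 'D_v f x)) => //.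
  move=> x Ux; rewrite [RHS]deriveM//; apply: diff_derivable; [exact: df|exact: dg].
by apply: CkD => //; apply: IH => //; [exact: cg|exact: cf].
Qed.

Lemma Ck_prod k U (I : Type) (r : seq I) (f : I -> 'rV[R]_d -> R) : open U ->
  (forall i, Ck k U (f i)) -> Ck k U (fun x => \prod_(i <- r) f i x).
Proof.
move=> oU h; elim: r => [|i r IH].
  apply: (@Ck_congr _ _ _ (fun=> 1 : R)) => //; last exact: Ck_cst.
  by move=> x _; rewrite big_nil.
apply: (@Ck_congr _ _ _ (fun x => f i x * \prod_(i <- r) f i x)) => //; last exact: CkM.
by move=> x _; rewrite big_cons.
Qed.

Lemma CkV k U (f : 'rV[R]_d -> R) : open U -> (forall x, U x -> f x != 0) ->
  Ck k U f -> Ck k U (fun x => (f x)^-1).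
Proof.
move=> oU f0; elim: k f f0 => [|k IH] f f0.
  by move=> cf x Ux; apply: continuousV; [exact: f0|exact: cf].
move=> cf; have cf' := IH _ f0 (CkS cf).
case: cf => [df cf]; split=> [x Ux|v].
  by apply: differentiableV; [exact: df|exact: f0].
apply: (@Ck_congr _ _ _ (fun x => -1 * ((f x)^-1 * (f x)^-1) * 'D_v f x)) => //.
  move=> x Ux; rewrite [RHS]deriveV ?f0//; last exact/diff_derivable/df.
  by rewrite expr2 /GRing.scale /= mulN1r invfM.
apply: CkM => //; last exact: cf.
have c2 := CkM oU cf' cf'.
exact: (@CkM k U (fun=> -1) _ oU (Ck_cst _ _ _) c2).
Qed.

Lemma Ck_scalel V k U (f : 'rV[R]_d -> R) (w : V) : open U ->
  Ck k U f -> Ck k U (fun x => f x *: w).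
Proof.
move=> oU; elim: k f => [|k IH] f.
  by move=> cf x Ux; apply: continuousZr_tmp; exact: cf.
move=> [df cf]; split=> [x Ux|v].
  by apply: differentiableZl; exact: df.
apply: (@Ck_congr _ _ _ (fun x => 'D_v f x *: w)) => //; last first.
  by apply: IH; exact: cf.
move=> x Ux; have dfx := df x Ux; rewrite !deriveE//; last exact: differentiableZl.
by rewrite diffZl.
Qed.

Lemma Ck_coord m k U (f : 'rV[R]_d -> 'rV[R]_m) i : open U ->
  Ck k U f -> Ck k U (fun x => f x ord0 i).
Proof.
move=> oU; elim: k f => [|k IH] f.
  move=> cf x Ux; apply: (@continuous_comp _ _ _ f (fun M : 'rV[R]_m => M ord0 i)).
    exact: cf.
  exact: coord_continuous.
move=> [df cf]; split=> [x Ux|v].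
  apply: (@differentiable_comp _ _ _ _ f (fun M : 'rV[R]_m => M ord0 i)).
    exact: df.
  exact: differentiable_coord.
apply: (@Ck_congr _ _ _ (fun x => 'D_v f x ord0 i)) => //; last by apply: IH; exact: cf.
by move=> x Ux; rewrite derive_mx ?mxE//; exact/diff_derivable/df.
Qed.

Lemma Ck_rowP m k U (f : 'rV[R]_d -> 'rV[R]_m) : open U ->
  (forall i, Ck k U (fun x => f x ord0 i)) -> Ck k U f.
Proof.
move=> oU h.
apply: (@Ck_congr _ _ _ (fun x => \sum_i f x ord0 i *: delta_mx ord0 i)) => //.
  by move=> x _; rewrite -row_sum_delta.
by apply: Ck_sum => // i; exact: Ck_scalel.
Qed.

End Calc.

Lemma derive_chain (R : realType) (U V W : normedModType R) (f : U -> V) (g : V -> W)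
    (x v : U) : differentiable f x -> differentiable g (f x) ->
  'D_v (g \o f) x = 'D_('D_v f x) g (f x).
Proof.
move=> df dg; rewrite !deriveE//; last exact: differentiable_comp.
by rewrite diff_comp.
Qed.

Lemma derive_chain_real (R : realType) (V : normedModType R) (f : V -> R) (g : R -> R)
    (x v : V) : differentiable f x -> derivable g (f x) 1 ->
  'D_v (g \o f) x = 'D_v f x * 'D_1 g (f x).
Proof.
move=> df /derivable1_diffP dg; rewrite derive_chain//.
move: ('D_v f x) (f x) dg => c y dg; rewrite !deriveE//.
by rewrite -[c in LHS]mulr1 -[c * 1]/(c *: 1) linearZ.
Qed.

Lemma derive_coord (R : realType) (d : nat) (V : normedModType R)
    (f : 'rV[R]_d -> V) x v : differentiable f x ->
  'D_v f x = \sum_i v ord0 i *: 'D_(delta_mx ord0 i) f x.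
Proof.
move=> df; rewrite deriveE// {1}[v]row_sum_delta linear_sum.
by apply: eq_bigr => i _; rewrite linearZ deriveE.
Qed.

Section Calc2.
Variables (R : realType) (d : nat).
Implicit Types (U : set 'rV[R]_d) (V : normedModType R).

Lemma Ck_sqrt k U (f : 'rV[R]_d -> R) : open U -> (forall x, U x -> 0 < f x) ->
  Ck k U f -> Ck k U (fun x => Num.sqrt (f x)).
Proof.
move=> oU f0; elim: k f f0 => [|k IH] f f0.
  move=> cf x Ux; apply: (@continuous_comp _ _ _ f (@Num.sqrt R)).
    exact: cf.
  exact: sqrt_continuous.
move=> cf; have cs := IH _ f0 (CkS cf).
have s0 x : U x -> Num.sqrt (f x) != 0.
  by move=> Ux; rewrite gt_eqF// sqrtr_gt0 f0.
have ci := CkV oU s0 cs.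
case: cf => [df cf]; split=> [x Ux|v].
  apply: (@differentiable_comp _ _ _ _ f (@Num.sqrt R)); first exact: df.
  by apply/derivable1_diffP; case: (is_derive1_sqrt (f0 x Ux)).
have c2 := CkM oU (Ck_cst k U (2^-1 : R)) (CkM oU (cf v) ci).
apply: Ck_congr c2 => // x Ux.
rewrite (@derive_chain_real _ _ f (@Num.sqrt R)).
- by rewrite derive_sqrt ?f0// invfM; ring.
- exact: df.
- by case: (is_derive1_sqrt (f0 x Ux)).
Qed.

(** By the chain rule the derivative of [f \o phi] is a combination of the partial
    derivatives of [f] taken along [phi], with the derivatives of [phi] as
    coefficients; so induction on [k] reduces to products and sums. *)
Lemma Ck_comp e k U (U' : set 'rV[R]_e) (phi : 'rV[R]_d -> 'rV[R]_e) (f : 'rV[R]_e -> R) :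
  open U -> (forall x, U x -> U' (phi x)) ->
  Ck k U phi -> Ck k U' f -> Ck k U (fun x => f (phi x)).
Proof.
move=> oU sU; elim: k f => [|k IH] f.
  by move=> cp cf x Ux; apply: (continuous_comp (cp _ Ux)); exact/cf/sU.
move=> cp; have cp' := CkS cp; case: cp => [dp cp] [df cf].
split=> [x Ux|v].
  by apply: (@differentiable_comp _ _ _ _ phi f); [exact: dp|exact/df/sU].
apply: (@Ck_congr _ _ _ _ _ (fun x => \sum_i 'D_v phi x ord0 i
    * 'D_(delta_mx ord0 i) f (phi x))) => //.
  move=> x Ux; rewrite (@derive_chain _ _ _ _ phi f); last 2 first.
  - exact: dp.
  - exact/df/sU.
  by rewrite [RHS]derive_coord//; exact: (df _ (sU _ Ux)).
apply: Ck_sum => // i; apply: CkM => //.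
  by apply: Ck_coord => //; exact: cp.
exact: (IH ('D_(delta_mx ord0 i) f) cp' (cf _)).
Qed.

Lemma Ck_comp_row e m k U (U' : set 'rV[R]_e) (phi : 'rV[R]_d -> 'rV[R]_e)
    (f : 'rV[R]_e -> 'rV[R]_m) :
  open U -> open U' -> (forall x, U x -> U' (phi x)) ->
  Ck k U phi -> Ck k U' f -> Ck k U (fun x => f (phi x)).
Proof.
move=> oU oU' sU cp cf; apply: Ck_rowP => // i.
by apply: (Ck_comp (f := fun y => f y ord0 i) oU sU cp); exact: Ck_coord.
Qed.

Lemma Ck_id k U : Ck k U (@id 'rV[R]_d).
Proof.
case: k => [x _|k]; first exact: cvg_id.
split=> [x _|v]; first exact: ex_diff.
have -> : (fun x => 'D_v id x) = (fun=> v) :> ('rV[R]_d -> 'rV[R]_d).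
  by apply/funext => x; rewrite derive_id.
exact: Ck_cst.
Qed.

(** A derivative in a variable direction is a combination of the partial derivatives,
    with the components of the direction as coefficients. *)
Lemma Ck_derive k U (f : 'rV[R]_d -> R) (X : 'rV[R]_d -> 'rV[R]_d) : open U ->
  Ck k U X -> Ck k.+1 U f -> Ck k U (fun x => 'D_(X x) f x).
Proof.
move=> oU cX [df cf].
apply: (@Ck_congr _ _ _ _ _ (fun x => \sum_i X x ord0 i
    * 'D_(delta_mx ord0 i) f x)) => //.
  by move=> x Ux; rewrite [RHS]derive_coord//; exact: df.
apply: Ck_sum => // i; apply: CkM => //; first exact: Ck_coord.
exact: cf.
Qed.

Lemma is_derive_line (f : 'rV[R]_d -> R) a v (t : R) :
  differentiable f (a + t *: v) ->
  is_derive t (1 : R) (fun s => f (a + s *: v)) ('D_v f (a + t *: v)).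
Proof.
move=> df.
have [dl El] : is_diff t (fun s : R => a + s *: v) ( *:%R ^~ v).
  have E := is_diffD (is_diff_cst a t) (is_diff_scalel t v).
  by apply: is_diff_eq E _; apply/funext => s; rewrite /= !fctE add0r.
have dc : differentiable (fun s : R => f (a + s *: v)) t.
  exact: (@differentiable_comp _ _ _ _ (fun s : R => a + s *: v) f).
apply: DeriveDef; first exact/derivable1_diffP.
rewrite deriveE// (@diff_comp _ _ _ _ (fun s : R => a + s *: v) f)//= El.
by rewrite scale1r deriveE.
Qed.

Lemma mvt_line (f : 'rV[R]_d -> R) a v (h : R) : 0 < h ->
  (forall t, 0 <= t <= h -> differentiable f (a + t *: v)) ->
  exists2 xi, 0 < xi < h & f (a + h *: v) - f a = 'D_v f (a + xi *: v) * h.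
Proof.
move=> h0 df.
have [|||xi] := @MVT R (fun s => f (a + s *: v)) (fun s => 'D_v f (a + s *: v)) 0 h.
- exact: h0.
- move=> t; rewrite in_itv/= => /andP[t0 th].
  by apply: (@is_derive_line f a v t); apply: df; rewrite !ltW.
- apply: derivable_within_continuous => t; rewrite in_itv/= => th.
  by case: (@is_derive_line f a v t (df _ th)).
- by rewrite in_itv/= scale0r addr0 subr0 => xih E; exists xi.
Qed.

Lemma derive_translate V (f : 'rV[R]_d -> V) c x v :
  'D_v (fun y => f (y + c)) x = 'D_v f (x + c).
Proof.
rewrite /derive.
have -> // : (fun h => h^-1 *: (((fun y => f (y + c)) \o shift x) (h *: v) - f (x + c))) =
    (fun h => h^-1 *: ((f \o shift (x + c)) (h *: v) - f (x + c))).
by apply/funext => h /=; rewrite addrA.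
Qed.

Lemma differentiable_translate V (f : 'rV[R]_d -> V) c x :
  differentiable f (x + c) -> differentiable (fun y => f (y + c)) x.
Proof.
move=> df; apply: (@differentiable_comp _ _ _ _ (fun y => y + c) f) => //.

Qed.

(** The mean value theorem is used first for the increment of [f] by [h *: w], as a
    function of the displacement along [v], then for ['D_v f] along [w]. *)
Lemma second_difference_mvt (f : 'rV[R]_d -> R) a v w (h : R) : 0 < h ->
  (forall s t, 0 <= s <= h -> 0 <= t <= h ->
     differentiable f (a + s *: v + t *: w) /\
     differentiable ('D_v f) (a + s *: v + t *: w)) ->
  exists xi eta, [/\ 0 < xi < h, 0 < eta < h &
   f (a + h *: v + h *: w) - f (a + h *: v) - (f (a + h *: w) - f a) =
   'D_w ('D_v f) (a + xi *: v + eta *: w) * h * h].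
Proof.
move=> h0 df.
have hh : 0 <= h <= h by rewrite lexx ltW.
have h00 : 0 <= (0 : R) <= h by rewrite lexx ltW.
pose g y := f (y + h *: w) - f y.
have [|xi xih Eg] := @mvt_line g a v h h0.
  move=> t th; apply: differentiableB.
    apply: differentiable_translate; exact: (df _ _ th hh).1.
  by have := (df _ _ th h00).1; rewrite scale0r addr0.
have xih' : 0 <= xi <= h by case/andP: xih => /ltW -> /ltW ->.
have [|eta etah Ef] := @mvt_line ('D_v f) (a + xi *: v) w h h0.
  by move=> t th; exact: (df _ _ xih' th).2.
exists xi, eta; split=> //.
rewrite -Ef; change (g (a + h *: v) - g a =
  ('D_v f (a + xi *: v + h *: w) - 'D_v f (a + xi *: v)) * h).
rewrite Eg; congr (_ * _).
have d1 : differentiable f (a + xi *: v + h *: w) := (df _ _ xih' hh).1.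
have d0 : differentiable f (a + xi *: v).
  by have := (df _ _ xih' h00).1; rewrite scale0r addr0.
rewrite /g deriveB.
- by rewrite derive_translate.
- exact/diff_derivable/differentiable_translate.
- exact/diff_derivable.
Qed.

(** Symmetry of second derivatives.  The second difference of [f] along [v] and [w]
    does not depend on the order of [v] and [w]; by [second_difference_mvt] it is a
    value of either mixed derivative near [x], and both are continuous at [x]. *)
Lemma derive_comm U (f : 'rV[R]_d -> R) v w x : open U -> Ck 2 U f -> U x ->
  'D_w ('D_v f) x = 'D_v ('D_w f) x.
Proof.
move=> oU [df c1] Ux.
have [dv cv] := c1 v; have [dw cw] := c1 w.
have nU : nbhs x U by exact: open_nbhs_nbhs.
apply/eqP; rewrite -subr_eq0 -normr_le0; apply/ler_addgt0Pr => e e0; rewrite add0r.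
have e20 : 0 < e / 2 by rewrite divr_gt0.
have N1 : \forall y \near x, `|'D_w ('D_v f) x - 'D_w ('D_v f) y| < e / 2.
  by have /cvgrPdist_lt /(_ _ e20) := cv w x Ux.
have N2 : \forall y \near x, `|'D_v ('D_w f) x - 'D_v ('D_w f) y| < e / 2.
  by have /cvgrPdist_lt /(_ _ e20) := cw v x Ux.
have : \forall y \near x, [/\ U y, `|'D_w ('D_v f) x - 'D_w ('D_v f) y| < e / 2
    & `|'D_v ('D_w f) x - 'D_v ('D_w f) y| < e / 2].
  by apply: filterS2 (filterI nU N1) N2 => y [? ?] ?; split.
move=> /nbhs_normP[r /= r0 Hr].
(* A step small enough for the parallelogram spanned by [h *: v] and [h *: w] at [x] to
   stay in the ball of radius [r]. *)
pose h := r / (2 * (`|v| + `|w| + 1)).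
have n0 : 0 < 2 * (`|v| + `|w| + 1) by rewrite mulr_gt0// ltr_wpDl ?addr_ge0.
have h0 : 0 < h by rewrite divr_gt0.
have hr : h * (`|v| + `|w|) < r.
  rewrite /h mulrAC ltr_pdivrMr// ltr_pM2l//.
  by have := normr_ge0 v; have := normr_ge0 w; lra.
have near_pt s t : 0 <= s <= h -> 0 <= t <= h ->
    [/\ U (x + s *: v + t *: w),
    `|'D_w ('D_v f) x - 'D_w ('D_v f) (x + s *: v + t *: w)| < e / 2
    & `|'D_v ('D_w f) x - 'D_v ('D_w f) (x + s *: v + t *: w)| < e / 2].
  move=> /andP[s0 sh] /andP[t0 th]; apply: Hr => /=.
  rewrite -addrA opprD addNKr normrN.
  apply: le_lt_trans hr; apply: le_trans (ler_normD _ _) _.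
  by rewrite !normrZ !ger0_norm// mulrDr lerD// ler_wpM2r.
have [|xi [eta [xih etah E1]]] := @second_difference_mvt f x v w h h0.
  by move=> s t sh th; have [Uy _ _] := near_pt _ _ sh th; split; [exact: df|exact: dv].
have [|xi' [eta' [xih' etah' E2]]] := @second_difference_mvt f x w v h h0.
  move=> s t sh th; rewrite addrAC.
  by have [Uy _ _] := near_pt _ _ th sh; split; [exact: df|exact: dw].
have wk (z : R) : 0 < z < h -> 0 <= z <= h by case/andP => /ltW -> /ltW ->.
have [_ + _] := near_pt _ _ (wk _ xih) (wk _ etah).
have [_ _ +] := near_pt _ _ (wk _ etah') (wk _ xih').
rewrite [x + _ + xi' *: w]addrAC.
set A := 'D_w _ _; set B := 'D_v _ _; move: E1 E2.
rewrite [x + h *: w + h *: v]addrAC.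
set A' := 'D_w _ _; set B' := 'D_v _ _ => E1 E2 HB HA.
have {}E1 := esym E1; have {}E2 := esym E2.
move: A B A' B' E1 E2 HA HB => A B A' B'.
move: (f _) (f _) (f _) (f _) => f1 f2 f3 f4 E1 E2 HA HB.
have AB : A' = B'.
  have hn : h * h != 0 by rewrite mulf_neq0// gt_eqF.
  have gen (a b c k : R) : a - b - (c - k) = a - c - (b - k) by ring.
  have E3 : A' * h * h = B' * h * h by rewrite E1 E2; exact: gen.
  by apply: (mulIf hn); rewrite [LHS]mulrA [RHS]mulrA.
have gen (a b c : R) : a - b = (a - c) - (b - c) by ring.
rewrite (gen A B B') -{1}AB.
apply: le_trans (ler_normB _ _) _; rewrite [e]splitr; exact: ltW (ltrD HA HB).
Qed.

End Calc2.

Lemma Ck_dot (R : realType) (n m k : nat) (U : set 'rV[R]_n) (f g : 'rV[R]_n -> 'rV[R]_m) :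
  open U -> Ck k U f -> Ck k U g ->
  Ck k U (fun z => dot (f z) (g z)).
Proof.
by move=> oU cf cg; apply: Ck_sum => // i; apply: CkM => //; exact: Ck_coord.
Qed.

Lemma derive_dot (R : realType) (n m : nat) (f g : 'rV[R]_n -> 'rV[R]_m) x v :
  differentiable f x -> differentiable g x ->
  'D_v (fun z => dot (f z) (g z)) x = dot ('D_v f x) (g x) + dot (f x) ('D_v g x).
Proof.
move=> df dg.
have dfi i : derivable (fun y => f y ord0 i) x v.
  apply/diff_derivable/(@differentiable_comp _ _ _ _ f (fun M : 'rV[R]_m => M ord0 i)) => //.
  exact: differentiable_coord.
have dgi i : derivable (fun y => g y ord0 i) x v.
  apply/diff_derivable/(@differentiable_comp _ _ _ _ g (fun M : 'rV[R]_m => M ord0 i)) => //.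
  exact: differentiable_coord.
rewrite [X in 'D_v X _](_ : _ = \sum_i (fun y => f y ord0 i) *
   (fun y => g y ord0 i)); last first.
  by apply/funext => y; rewrite fct_sumE.
rewrite derive_sum; last by move=> i; apply: derivableM.
rewrite /dot -big_split; apply: eq_bigr => i _ /=.
rewrite deriveM// !derive_mx ?mxE; [|exact: diff_derivable..].
by rewrite /= addrC; congr (_ + _); rewrite mulrC.
Qed.

Lemma Ck_derive_row (R : realType) (d m k : nat) (U : set 'rV[R]_d)
    (f : 'rV[R]_d -> 'rV[R]_m) (X : 'rV[R]_d -> 'rV[R]_d) : open U ->
  Ck k U X -> Ck k.+1 U f -> Ck k U (fun x => 'D_(X x) f x).
Proof.
move=> oU cX cf; apply: Ck_rowP => // i.
apply: (Ck_congr oU _ (Ck_derive oU cX (Ck_coord i oU cf))) => x Ux.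
case: cf => df _; rewrite [in RHS]derive_mx ?mxE//; exact/diff_derivable/df.
Qed.

Lemma Ck_scale_row (R : realType) (d m k : nat) (U : set 'rV[R]_d)
    (f : 'rV[R]_d -> R) (X : 'rV[R]_d -> 'rV[R]_m) : open U ->
  Ck k U f -> Ck k U X -> Ck k U (fun x => f x *: X x).
Proof.
move=> oU cf cX; apply: Ck_rowP => // i.
apply: (Ck_congr oU _ (CkM oU cf (Ck_coord i oU cX))) => x Ux.
by rewrite mxE.
Qed.

(** Leibniz rule for [y |-> 'D_(eta y) F y]: the direction and the function are
    differentiated separately.  Second derivatives along vector fields are
    compared with those in fixed directions through this formula. *)
Lemma derive_along_field (R : realType) (d : nat) (U : set 'rV[R]_d) (F : 'rV[R]_d -> R)
   (eta : 'rV[R]_d -> 'rV[R]_d) x v : open U -> U x -> Ck 2 U F -> Ck 1 U eta ->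
   'D_v (fun y => 'D_(eta y) F y) x = 'D_('D_v eta x) F x + 'D_v ('D_(eta x) F) x.
Proof.
move=> oU Ux [dF cF] [de _].
have nU : nbhs x U by exact: open_nbhs_nbhs.
have dFi (w : 'rV_d) : differentiable ('D_w F) x by have [h _] := cF w; exact: h.
rewrite (@near_eq_derive _ _ _ _
   (\sum_i (fun y => eta y ord0 i) * 'D_(delta_mx ord0 i) F)); last first.
  apply: filterS nU => y Uy; rewrite derive_coord//; last exact: dF.
  by rewrite fct_sumE.
have dei i : differentiable (fun y => eta y ord0 i) x.
  apply: (@differentiable_comp _ _ _ _ eta (fun M : 'rV[R]_d => M ord0 i)).
    exact: de.
  exact: differentiable_coord.
rewrite derive_sum; last first.
  by move=> i; apply: diff_derivable; apply: differentiableM.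
rewrite (@near_eq_derive _ _ _ ('D_(eta x) F)
   (\sum_i eta x ord0 i *: ('D_(delta_mx ord0 i) F : 'rV[R]_d -> R))); last first.
  apply: filterS nU => y Uy; rewrite derive_coord//; last exact: dF.
  by rewrite fct_sumE.
rewrite derive_sum; last first.
  by move=> i; apply: diff_derivable; apply: differentiableZ.
rewrite (derive_coord _ (dF _ Ux)) -big_split/=; apply: eq_bigr => i _.
rewrite deriveM; [|exact: diff_derivable|exact: diff_derivable].
rewrite deriveZ; last exact: diff_derivable.
rewrite addrC; congr (_ + _).
rewrite [in RHS]derive_mx ?mxE; last exact/diff_derivable/de.
exact: mulrC.
Qed.

(** * Calculus on a manifold *)

Section MfdCalc.
Variables (R : realType) (d : nat) (M : smoothManifold R d).
Implicit Types (U : set M) (V : normedModType R) (c p q : M) (X Y : M -> 'rV[R]_d).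

Lemma chart_imageP c U y : (chart c @` (chdom c `&` U)) y <->
  [/\ (chart c @` chdom c) y, chdom c (chinv c y) & U (chinv c y)].
Proof.
split=> [[q [cq Uq] <-]|[[q cq <-]]].
  by rewrite chartK//; split => //; exists q.
by rewrite chartK// => _ Uq; exists q.
Qed.

Lemma chart_image_open c U : open U -> open (chart c @` (chdom c `&` U)).
Proof.
move=> oU; rewrite openE => y /chart_imageP [iy cy Uy].
have ni : nbhs y (chart c @` chdom c) by apply: open_nbhs_nbhs; split => //; exact: chart_open.
have nU : \forall z \near y, U (chinv c z).
  by apply: (chinv_continuous iy); exact: open_nbhs_nbhs.
rewrite /interior; near=> z; apply/chart_imageP.
have iz : (chart c @` chdom c) z by near: z.
split=> //; last by near: z.
by case: iz => q cq <-; rewrite chartK.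
Unshelve. all: by end_near. Qed.

Arguments chart_image_open c [U].

Lemma chart_nbhs c U q : open U -> chdom c q -> U q ->
  \forall y \near chart c q, (chart c @` (chdom c `&` U)) y.
Proof.
move=> oU cq Uq; apply: open_nbhs_nbhs; split; first exact: chart_image_open.
by exists q.
Qed.

Lemma mem_chart_image c U q : chdom c q -> U q -> (chart c @` (chdom c `&` U)) (chart c q).
Proof. by move=> cq Uq; exists q. Qed.

Lemma smooth_congr V U (f g : M -> V) : open U -> (forall q, U q -> f q = g q) ->
  smooth_on U f -> smooth_on U g.
Proof.
move=> oU fg sf c k; apply: Ck_congr (sf c k); first exact: chart_image_open.
by move=> y /chart_imageP [_ _ /fg].
Qed.

Lemma smooth_sub V U U' (f : M -> V) : U' `<=` U -> smooth_on U f -> smooth_on U' f.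
Proof.
move=> sU sf c k; apply: Ck_sub (sf c k) => y [q [cq /sU Uq] <-].
exact: mem_chart_image.
Qed.

Lemma smooth_local V U (f : M -> V) :
  (forall q, U q -> exists2 U', U' q & smooth_on U' f) -> smooth_on U f.
Proof.
move=> h c k; apply: Ck_local => y [q [cq /h[U' U'q sf]] <-].
by exists (chart c @` (chdom c `&` U')); [exact: mem_chart_image|exact: sf].
Qed.

Lemma smooth_cst V U (a : V) : smooth_on U (fun=> a).
Proof. by move=> c k; exact: Ck_cst. Qed.

Lemma smoothD V U (f g : M -> V) : open U -> smooth_on U f -> smooth_on U g ->
  smooth_on U (fun q => f q + g q).
Proof.
move=> oU sf sg c k.
exact: (CkD (chart_image_open c oU) (sf c k) (sg c k)).
Qed.

Lemma smooth_sum V U (I : Type) (r : seq I) (f : I -> M -> V) : open U ->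
  (forall i, smooth_on U (f i)) -> smooth_on U (fun q => \sum_(i <- r) f i q).
Proof.
move=> oU sf c k.
apply: (@Ck_sum _ _ _ _ _ _ _ (fun i => f i \o chinv c)); first exact: chart_image_open.
by move=> i; exact: sf.
Qed.

Lemma smoothM U (f g : M -> R) : open U -> smooth_on U f -> smooth_on U g ->
  smooth_on U (fun q => f q * g q).
Proof.
move=> oU sf sg c k.
exact: (CkM (chart_image_open c oU) (sf c k) (sg c k)).
Qed.

Lemma smooth_prod U (I : Type) (r : seq I) (f : I -> M -> R) : open U ->
  (forall i, smooth_on U (f i)) -> smooth_on U (fun q => \prod_(i <- r) f i q).
Proof.
move=> oU sf c k.
apply: (@Ck_prod _ _ _ _ _ _ (fun i => f i \o chinv c)); first exact: chart_image_open.
by move=> i; exact: sf.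
Qed.

Lemma smoothN U (f : M -> R) : open U -> smooth_on U f -> smooth_on U (fun q => - f q).
Proof.
move=> oU sf; have := smoothM oU (smooth_cst U (-1 : R)) sf.
by apply: smooth_congr => // q _; rewrite mulN1r.
Qed.

Lemma smoothB U (f g : M -> R) : open U -> smooth_on U f -> smooth_on U g ->
  smooth_on U (fun q => f q - g q).
Proof. by move=> oU sf sg; apply: smoothD => //; exact: smoothN. Qed.

Lemma smoothV U (f : M -> R) : open U -> (forall q, U q -> f q != 0) ->
  smooth_on U f -> smooth_on U (fun q => (f q)^-1).
Proof.
move=> oU f0 sf c k.
apply: (CkV (chart_image_open c oU) _ (sf c k)) => y /chart_imageP [_ _].
exact: f0.
Qed.

Lemma smooth_sqrt U (f : M -> R) : open U -> (forall q, U q -> 0 < f q) ->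
  smooth_on U f -> smooth_on U (fun q => Num.sqrt (f q)).
Proof.
move=> oU f0 sf c k.
apply: (Ck_sqrt (chart_image_open c oU) _ (sf c k)) => y /chart_imageP [_ _].
exact: f0.
Qed.

Lemma smooth_coord m U (f : M -> 'rV[R]_m) i : open U -> smooth_on U f ->
  smooth_on U (fun q => f q ord0 i).
Proof. by move=> oU sf c k; exact: (Ck_coord i (chart_image_open c oU) (sf c k)). Qed.

Lemma smooth_row m U (f : M -> 'rV[R]_m) : open U ->
  (forall i, smooth_on U (fun q => f q ord0 i)) -> smooth_on U f.
Proof.
by move=> oU sf c k; apply: Ck_rowP (chart_image_open c oU) _ => i; exact: sf.
Qed.

Lemma smooth_dot m U (f g : M -> 'rV[R]_m) : open U -> smooth_on U f ->
  smooth_on U g -> smooth_on U (fun q => dot (f q) (g q)).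
Proof.
move=> oU sf sg; apply: smooth_sum => // i.
by apply: smoothM => //; apply: smooth_coord.
Qed.

Lemma smooth_scale m U (f : M -> R) (g : M -> 'rV[R]_m) : open U -> smooth_on U f ->
  smooth_on U g -> smooth_on U (fun q => f q *: g q).
Proof.
move=> oU sf sg; apply: smooth_row => // i.
have := smoothM oU sf (smooth_coord i oU sg).
by apply: smooth_congr => // q _; rewrite mxE.
Qed.

Lemma smooth_diff V U (f : M -> V) c q : smooth_on U f -> chdom c q -> U q ->
  differentiable (f \o chinv c) (chart c q).
Proof.
by move=> sf cq Uq; have [df _] := sf c 1%N; apply: df; exact: mem_chart_image.
Qed.

Lemma chart_smooth c : smooth_on (chdom c) (chart c).
Proof. by move=> e; exact: transition_smooth. Qed.

Lemma chart_diff c e q : chdom c q -> chdom e q ->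
  differentiable (chart e \o chinv c) (chart c q).
Proof. by move=> cq eq; exact: smooth_diff (chart_smooth e) cq eq. Qed.

Lemma transition_near c e q : chdom c q -> chdom e q ->
  \forall y \near chart c q, [/\ chdom c (chinv c y), chdom e (chinv c y),
    chart c (chinv c y) = y & chinv e (chart e (chinv c y)) = chinv c y].
Proof.
move=> cq eq; apply: filterS (chart_nbhs (chdom_open e) cq eq).
by move=> y [z [cz ez] <-]; rewrite (chartK cz) (chartK ez).
Qed.

(** Since the tangent space at [q] is coordinatized by the chart of index [q], every
    computation in a fixed chart [c] goes through this change of coordinates. *)
Lemma vder_chart V (f : M -> V) c q v : chdom c q ->
  differentiable (f \o chinv c) (chart c q) ->
  vder f q v = 'D_(vder (chart c) q v) (f \o chinv c) (chart c q).
Proof.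
move=> cq df; rewrite /vder.
have qq := chdom_center q.
have E : chart c q = (chart c \o chinv q) (chart q q) by rewrite /= chartK.
rewrite E -derive_chain; last 2 first.
- exact: chart_diff.
- by rewrite -E.
apply: near_eq_derive; apply: filterS (transition_near qq cq) => y [_ _ _] /=.
by move=> ->.
Qed.

Lemma vder_linear V (f : M -> V) q : differentiable (f \o chinv q) (chart q q) ->
  linear (vder f q).
Proof. by move=> df a u v; rewrite /vder !deriveE// linearP. Qed.

Lemma vderB V (f : M -> V) q u v : differentiable (f \o chinv q) (chart q q) ->
  vder f q (u - v) = vder f q u - vder f q v.
Proof. by move=> df; rewrite /vder !deriveE// linearB. Qed.

Lemma vder_chart_id q v : vder (chart q) q v = v.
Proof.
rewrite /vder (@near_eq_derive _ _ _ _ id); first by rewrite derive_id.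
by apply: filterS (transition_near (chdom_center q) (chdom_center q)) => y [].
Qed.

Lemma vder_chart_inj c q v : chdom c q -> vder (chart c) q v = 0 -> v = 0.
Proof.
move=> cq h; rewrite -(vder_chart_id q v) (vder_chart _ cq) ?h ?derive0//.
exact: (chart_diff cq (chdom_center q)).
Qed.

Lemma vder_congr V U (f g : M -> V) q v : open U -> U q ->
  (forall z, U z -> f z = g z) -> vder f q v = vder g q v.
Proof.
move=> oU Uq fg; apply: near_eq_derive.
apply: filterS (chart_nbhs oU (chdom_center q) Uq) => y [z [qz Uz] <-] /=.
by rewrite (chartK qz) fg.
Qed.

(** One chart is enough to check smoothness, the transition maps being smooth. *)
Lemma smooth_single m U c (f : M -> 'rV[R]_m) : open U -> U `<=` chdom c ->
  Coo (chart c @` U) (f \o chinv c) -> smooth_on U f.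
Proof.
move=> oU sU cf e k.
have UE : chart c @` U = chart c @` (chdom c `&` U) by rewrite (setIidr sU).
have oc := chart_image_open e oU.
have ct : Ck k (chart e @` (chdom e `&` U)) (chart c \o chinv e).
  apply: Ck_sub (@transition_smooth _ _ M e c k) => y [q [eq Uq] <-].
  by apply: mem_chart_image => //; exact: sU.
have := Ck_comp_row oc _ _ ct (cf k); rewrite UE => /(_ (chart_image_open c oU)) h.
apply: (Ck_congr oc _ (h _)) => y [q [eq Uq] <-] /=; rewrite (chartK eq).
  by rewrite (chartK (sU _ Uq)).
by apply: mem_chart_image => //; exact: sU.
Qed.

Lemma field_in_chart_diag X p : field_in_chart X p p = X p.
Proof. exact: vder_chart_id. Qed.

Lemma field_coo U X c : smooth_field U X ->
  Coo (chart c @` (chdom c `&` U)) (field_in_chart X c \o chinv c).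
Proof.
move=> sX k; apply: Ck_sub (sX c c k) => y [q [cq Uq] <-].
exact: mem_chart_image.
Qed.

Lemma smooth_vder U (f : M -> R) X : open U -> smooth_field U X -> smooth_on U f ->
  smooth_on U (fun q => vder f q (X q)).
Proof.
move=> oU sX sf c k.
have oc := chart_image_open c oU.
apply: (Ck_congr oc _ (Ck_derive oc (field_coo c sX k) (sf c k.+1))).
move=> y [q [cq Uq] <-]; rewrite /= (chartK cq) (vder_chart _ cq)//.
exact: smooth_diff sf cq Uq.
Qed.

Lemma smooth_field_sub U U' X : U' `<=` U -> smooth_field U X -> smooth_field U' X.
Proof.
by move=> sU sX c; apply: smooth_sub (sX c) => q [/sU Uq cq].
Qed.

Lemma vder_chart_linear c q (a : R) u v : chdom c q ->
  vder (chart c) q (a *: u + v) = a *: vder (chart c) q u + vder (chart c) q v.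
Proof. by move=> cq; apply: vder_linear; apply: chart_diff => //; exact: chdom_center. Qed.

Lemma smooth_field_scaleD U (f : M -> R) X Y : open U -> smooth_on U f ->
  smooth_field U X -> smooth_field U Y -> smooth_field U (fun q => f q *: X q + Y q).
Proof.
move=> oU sf sX sY c.
have oc : open (U `&` chdom c) by apply: openI => //; exact: chdom_open.
have sf' : smooth_on (U `&` chdom c) f by apply: smooth_sub sf => q [].
have := smoothD oc (smooth_scale oc sf' (sX c)) (sY c).
by apply: smooth_congr => // q [_ cq]; rewrite /field_in_chart vder_chart_linear.
Qed.

Lemma smooth_field0 U : open U -> smooth_field U (fun=> 0).
Proof.
move=> oU c; apply: (@smooth_congr _ _ (fun=> 0)).
- by apply: openI => //; exact: chdom_open.
- by move=> q _; rewrite /field_in_chart /vder derive0.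
- exact: smooth_cst.
Qed.

Lemma smooth_field_congr U X Y : open U -> (forall q, U q -> X q = Y q) ->
  smooth_field U X -> smooth_field U Y.
Proof.
move=> oU XY sX c; apply: smooth_congr (sX c).
- by apply: openI => //; exact: chdom_open.
- by move=> q [Uq _]; rewrite /field_in_chart XY.
Qed.

Lemma smooth_field_sum U (I : Type) (r : seq I) (f : I -> M -> R) (X : I -> M -> 'rV[R]_d) :
  open U -> (forall i, smooth_on U (f i)) -> (forall i, smooth_field U (X i)) ->
  smooth_field U (fun q => \sum_(i <- r) f i q *: X i q).
Proof.
move=> oU sf sX; elim: r => [|i r IH].
  by apply: smooth_field_congr (smooth_field0 oU) => // q _; rewrite big_nil.
apply: smooth_field_congr (smooth_field_scaleD oU (sf i) (sX i) IH) => // q _.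
by rewrite big_cons.
Qed.

End MfdCalc.
Arguments chart_image_open {R d M} c [U].

Section MfdCalc2.
Variables (R : realType) (d : nat) (M : smoothManifold R d).
Implicit Types (U : set M) (V : normedModType R) (c p q : M) (X Y : M -> 'rV[R]_d).

Lemma vder2_chart U (f : M -> R) Y c q v : open U -> smooth_on U f ->
  smooth_field U Y -> U q -> chdom c q ->
  let w := vder (chart c) q v in
  vder (fun z => vder f z (Y z)) q v =
  'D_('D_w (field_in_chart Y c \o chinv c) (chart c q)) (f \o chinv c) (chart c q)
  + 'D_w ('D_(field_in_chart Y c q) (f \o chinv c)) (chart c q).
Proof.
move=> oU sf sY Uq cq w.
rewrite (vder_chart _ cq); last by apply: smooth_diff (smooth_vder oU sY sf) cq Uq.
have oc := chart_image_open c oU.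
have := derive_along_field w oc (mem_chart_image cq Uq) (sf c 2%N) (field_coo c sY 1%N).
rewrite /= (chartK cq) => <-; apply: near_eq_derive.
apply: filterS (chart_nbhs oU cq Uq) => y [z [cz Uz] <-] /=.
rewrite (chartK cz) (vder_chart _ cz)//; exact: smooth_diff sf cz Uz.
Qed.

(** In the chart of index [p] the iterated derivatives differ from second derivatives
    in fixed directions by the derivative along the derivative of the field
    ([vder2_chart]).  The second derivatives cancel by symmetry, and what is left is
    the derivative along the components of the bracket. *)
Lemma vder_bracket U (f : M -> R) X Y p : open U -> U p -> smooth_on U f ->
  smooth_field U X -> smooth_field U Y ->
  vder f p (bracket X Y p) =
  vder (fun z => vder f z (Y z)) p (X p) - vder (fun z => vder f z (X z)) p (Y p).
Proof.
move=> oU Up sf sX sY; have pp := chdom_center p.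
rewrite (vder2_chart (X p) oU sf sY Up pp) (vder2_chart (Y p) oU sf sX Up pp) /=.
rewrite !field_in_chart_diag !vder_chart_id.
have oc := chart_image_open p oU.
have S := derive_comm (Y p) (X p) oc (sf p 2%N) (mem_chart_image pp Up).
have gen (a b s t : R) : s = t -> a - b = a + s - (b + t) by move=> ->; ring.
apply: etrans (gen _ _ _ _ S).
have df := smooth_diff sf pp Up.
rewrite /bracket; exact: (vderB _ _ df).
Qed.

(** The coordinate field of the chart [c] in the direction [a].  Its value at [q] has
    to be given in the chart of index [q]. *)
Definition coord_field c (a : 'I_d) q : 'rV[R]_d :=
  'D_(delta_mx ord0 a) (chart q \o chinv c) (chart c q).

Lemma coord_field_chart c a e q : chdom c q -> chdom e q ->
  field_in_chart (coord_field c a) e q =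
  'D_(delta_mx ord0 a) (chart e \o chinv c) (chart c q).
Proof.
move=> cq eq; rewrite /field_in_chart /coord_field /vder; have qq := chdom_center q.
have E : chart q q = (chart q \o chinv c) (chart c q) by rewrite /= chartK.
rewrite E -derive_chain; last 2 first.
- exact: chart_diff.
- by rewrite -E; exact: chart_diff.
apply: near_eq_derive; apply: filterS (transition_near cq qq) => y [_ _ _] /=.
by move=> ->.
Qed.

Lemma coord_field_id c a q : chdom c q ->
  field_in_chart (coord_field c a) c q = delta_mx ord0 a.
Proof.
move=> cq; rewrite coord_field_chart// (@near_eq_derive _ _ _ _ id) ?derive_id//.
by apply: filterS (transition_near cq cq) => y [].
Qed.

Lemma coord_field_smooth c a : smooth_field (chdom c) (coord_field c a).
Proof.
move=> e; apply: (@smooth_single _ _ _ _ _ c).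
- by apply: openI; exact: chdom_open.
- by move=> q [].
move=> k.
have oc : open (chart c @` (chdom c `&` chdom e)) by apply/chart_image_open/chdom_open.
have [_ /(_ (delta_mx ord0 a))] := @transition_smooth _ _ M c e k.+1.
apply: (Ck_congr oc) => y [q [cq eq] <-].
by rewrite /= (chartK cq) coord_field_chart.
Qed.

End MfdCalc2.

Section SmoothMx.
Variables (R : realType) (d : nat) (M : smoothManifold R d).

Lemma smooth_det m (U : set M) (A : M -> 'M[R]_m) : open U ->
  (forall i j, smooth_on U (fun q => A q i j)) ->
  smooth_on U (fun q => \det (A q)).
Proof.
move=> oU sA; apply: smooth_sum => // s; apply: smoothM => //; first exact: smooth_cst.
by apply: smooth_prod.
Qed.

Lemma smooth_invmx m (U : set M) (A : M -> 'M[R]_m) : open U ->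
  (forall q, U q -> A q \in unitmx) ->
  (forall i j, smooth_on U (fun q => A q i j)) ->
  forall i j, smooth_on U (fun q => invmx (A q) i j).
Proof.
move=> oU uA sA i j.
apply: (@smooth_congr _ _ _ _ _ (fun q => (\det (A q))^-1 *
   ((-1) ^+ (j + i) * \det (row' j (col' i (A q)))))) => //.
  by move=> q Uq; rewrite /invmx uA// !mxE.
apply: smoothM => //.
  apply: smoothV => //; last exact: smooth_det.
  by move=> q /uA; rewrite unitmxE unitfE.
apply: smoothM => //; first exact: smooth_cst.
apply: smooth_det => // k l.
by have := sA (lift j k) (lift i l); apply: smooth_congr => // q _; rewrite !mxE.
Qed.

Lemma smooth_mulmx m k (U : set M) (f : M -> 'rV[R]_m) (A : M -> 'M[R]_(m, k)) :
  open U -> smooth_on U f -> (forall i j, smooth_on U (fun q => A q i j)) ->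
  smooth_on U (fun q => f q *m A q).
Proof.
move=> oU sf sA; apply: smooth_row => // j.
apply: (@smooth_congr _ _ _ _ _ (fun q => \sum_i f q ord0 i * A q i j)) => //.
  by move=> q _; rewrite mxE.
by apply: smooth_sum => // i; apply: smoothM => //; exact: smooth_coord.
Qed.

Lemma vder_coord m (f : M -> 'rV[R]_m) q v i :
  differentiable (f \o chinv q) (chart q q) ->
  vder (fun z => f z ord0 i) q v = vder f q v ord0 i.
Proof.
by move=> df; rewrite [in RHS]/vder derive_mx ?mxE//; exact: diff_derivable.
Qed.

Lemma smooth_vder_row m (U : set M) (f : M -> 'rV[R]_m) X : open U ->
  smooth_field U X -> smooth_on U f -> smooth_on U (fun q => vder f q (X q)).
Proof.
move=> oU sX sf; apply: smooth_row => // i.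
apply: smooth_congr (smooth_vder oU sX (smooth_coord i oU sf)) => // q Uq.
by rewrite vder_coord//; apply: smooth_diff sf _ Uq; exact: chdom_center.
Qed.

Lemma vder_dot m (U : set M) (f g : M -> 'rV[R]_m) q v : smooth_on U f ->
  smooth_on U g -> U q ->
  vder (fun z => dot (f z) (g z)) q v = dot (vder f q v) (g q) + dot (f q) (vder g q v).
Proof.
move=> sf sg Uq; have qq := chdom_center q.
have Ef : f q = (f \o chinv q) (chart q q) by rewrite /= chartK.
have Eg : g q = (g \o chinv q) (chart q q) by rewrite /= chartK.
by rewrite Ef Eg; apply: derive_dot; [exact: smooth_diff sf qq Uq|exact: smooth_diff sg qq Uq].
Qed.

Lemma vderM (U : set M) (f g : M -> R) q v : smooth_on U f ->
  smooth_on U g -> U q ->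
  vder (fun z => f z * g z) q v = vder f q v * g q + f q * vder g q v.
Proof.
move=> sf sg Uq; have qq := chdom_center q.
have Ef : f q = (f \o chinv q) (chart q q) by rewrite /= chartK.
have Eg : g q = (g \o chinv q) (chart q q) by rewrite /= chartK.
have df := diff_derivable (v := v) (smooth_diff sf qq Uq).
have dg := diff_derivable (v := v) (smooth_diff sg qq Uq).
rewrite Ef Eg; apply: (etrans (deriveM df dg)).
by rewrite addrC; congr (_ + _); exact: mulrC.
Qed.

Lemma vder_cst (V : normedModType R) (a : V) q v : vder (fun _ : M => a) q v = 0.
Proof. exact: derive_cst. Qed.

Lemma vderD (U : set M) (f g : M -> R) q v : smooth_on U f ->
  smooth_on U g -> U q ->
  vder (fun z => f z + g z) q v = vder f q v + vder g q v.
Proof.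
move=> sf sg Uq; have qq := chdom_center q.
have df := diff_derivable (v := v) (smooth_diff sf qq Uq).
have dg := diff_derivable (v := v) (smooth_diff sg qq Uq).
exact: (deriveD df dg).
Qed.

Lemma vder_sum (U : set M) (I : Type) (r : seq I) (f : I -> M -> R) q v : open U ->
  (forall i, smooth_on U (f i)) -> U q ->
  vder (fun z => \sum_(i <- r) f i z) q v = \sum_(i <- r) vder (f i) q v.
Proof.
move=> oU sf Uq; elim: r => [|i r IH].
  have -> : (fun z => \sum_(i <- [::]) f i z) = (fun=> 0).
    by apply/funext => z; rewrite big_nil.
  by rewrite vder_cst big_nil.
have -> : (fun z => \sum_(j <- i :: r) f j z) = (fun z => f i z + \sum_(j <- r) f j z).
  by apply/funext => z; rewrite big_cons.
by rewrite big_cons -IH; apply: vderD (sf i) (smooth_sum _ oU sf) Uq.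
Qed.

End SmoothMx.

Lemma smooth_continuous (R : realType) (d : nat) (M : smoothManifold R d) (f : M -> R) :
  smooth_on setT f -> continuous f.
Proof.
move=> sf p; have pp := chdom_center p.
have c1 : {for chart p p, continuous (f \o chinv p)}.
  exact/differentiable_continuous/(smooth_diff sf pp I).
have c2 := continuous_comp (chart_continuous pp) c1.
have E : f p = (f \o chinv p \o chart p) p by rewrite /= chartK.
suff : f @ p --> f p by [].
rewrite E; apply: cvg_trans c2; apply: near_eq_cvg.
have : nbhs p (chdom p) by apply: open_nbhs_nbhs; split => //; exact: chdom_open.
by apply: filterS => z pz; rewrite /= chartK.
Qed.

(** * The differential of the embedding in the parallel frame *)

Section FComp.
Variables (R : realType) (d : nat) (Mt : weitzenbock R d).

Lemma fcompD (q : Mt) u v : fcomp q (u + v) = fcomp q u + fcomp q v.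
Proof. exact: mulmxDl. Qed.

Lemma fcompZ (q : Mt) a u : fcomp q (a *: u) = a *: fcomp q u.
Proof. by rewrite /fcomp scalemxAl. Qed.

Lemma fcompB (q : Mt) u v : fcomp q (u - v) = fcomp q u - fcomp q v.
Proof. exact: mulmxBl. Qed.

Lemma fcomp_inj (q : Mt) : injective (fcomp q).
Proof.
move=> u v h; rewrite -[u](mulmxKV (wframe_basis q)) -[v](mulmxKV (wframe_basis q)).
by rewrite -/(fcomp q u) h.
Qed.

Lemma fcomp_frame (q : Mt) (a : 'rV[R]_d) : fcomp q (\sum_i a ord0 i *: wframe i q) = a.
Proof.
rewrite /fcomp; have -> : \sum_i a ord0 i *: wframe i q = a *m \matrix_i wframe i q.
  by rewrite mulmx_sum_row; apply: eq_bigr => i _; rewrite rowK.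
by rewrite mulmxK// wframe_basis.
Qed.

(** The components of [w] in the parallel frame can be computed in any chart around
    [q].  The chart of index [q] used to define them varies with [q] in an arbitrary
    way, so that smoothness can only be seen after passing to a fixed chart. *)
Lemma fcomp_chart (c q : Mt) w : chdom c q ->
  fcomp q w = vder (chart c) q w *m invmx (\matrix_i field_in_chart (wframe i) c q) /\
  \matrix_i field_in_chart (wframe i) c q \in unitmx.
Proof.
move=> cq; have qq := chdom_center q.
have df := chart_diff qq cq.
pose L := jacobian (chart c \o chinv q) (chart q q).
have EL v : vder (chart c) q v = v *m L by rewrite /vder deriveEjacobian.
set F := \matrix_i wframe i q.
have EF : \matrix_i field_in_chart (wframe i) c q = F *m L.
  by apply/row_matrixP => i; rewrite row_mul !rowK /field_in_chart EL.
have uF : F \in unitmx := wframe_basis q.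
have uL : L \in unitmx.
  rewrite -row_free_unit; apply/row_freeP.
  have inj (v : 'rV[R]_d) : v *m L = 0 -> v = 0 by rewrite -EL; exact: vder_chart_inj.
  apply/row_freeP; rewrite -kermx_eq0; apply/eqP/row_matrixP => i.
  by rewrite row0; apply: inj; rewrite -row_mul mulmx_ker row0.
have uFL : F *m L \in unitmx by rewrite unitmx_mul uF.
rewrite EF; split => //.
have -> : vder (chart c) q w = fcomp q w *m (F *m L).
  by rewrite EL /fcomp -/F mulmxA mulmxKV.
by rewrite mulmxK.
Qed.

End FComp.

Section Theta.
Variables (R : realType) (n : nat) (M : smoothManifold R n).
Variables (Mt : weitzenbock R n.+1) (iota : M -> Mt).
Hypothesis emb : smooth_embedding iota.
Implicit Types (U : set M) (p q : M) (X Y : M -> 'rV[R]_n) (u v : 'rV[R]_n).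

(** The differential of [iota] read in the parallel frame: a 1-form on [M] with values
    in a fixed Euclidean space.  The induced metric is the dot product of its values,
    and the flat connection of the ambient manifold differentiates its components, so
    that the geometry of [M] becomes calculus with vector-valued functions. *)
Definition theta p v : 'rV[R]_n.+1 := fcomp (iota p) (dmap iota p v).

Lemma iota_cont : continuous iota.
Proof. by case: emb => -[]. Qed.

Lemma iota_preimage_open (O : set Mt) : open O -> open (iota @^-1` O).
Proof. by move=> oO; apply: open_comp => // x _; exact: iota_cont. Qed.

Lemma iota_chart_smooth (c' : Mt) : smooth_on (iota @^-1` chdom c') (chart c' \o iota).
Proof. by move=> c; case: emb => -[_ h] _ _ _; exact: h. Qed.

Lemma iota_diff p :
  differentiable (chart (iota p) \o iota \o chinv p) (chart p p).
Proof.
apply: smooth_diff (iota_chart_smooth (iota p)) (chdom_center p) _.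
exact: chdom_center.
Qed.

Lemma dmap_chart (c' : Mt) p v : chdom c' (iota p) ->
  vder (chart c') (iota p) (dmap iota p v) = vder (chart c' \o iota) p v.
Proof.
move=> cp; have pp := chdom_center p; have qq := chdom_center (iota p).
rewrite /dmap /vder.
have E : chart (iota p) (iota p) = (chart (iota p) \o iota \o chinv p) (chart p p).
  by rewrite /= chartK.
rewrite E -(@derive_chain _ _ _ _ (chart (iota p) \o iota \o chinv p)); last 2 first.
- exact: iota_diff.
- by rewrite -E; exact: chart_diff.
apply: near_eq_derive.
have oU : open (iota @^-1` chdom (iota p)) by exact/iota_preimage_open/chdom_open.
apply: filterS (chart_nbhs oU pp qq) => y [z [pz iz] <-] /=.
by rewrite (chartK pz) (chartK iz).
Qed.

Lemma dmap_linear p : linear (dmap iota p).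
Proof. exact: vder_linear (iota_diff p). Qed.

Lemma theta_lin p a u v : theta p (a *: u + v) = a *: theta p u + theta p v.
Proof. by rewrite /theta dmap_linear fcompD fcompZ. Qed.

Lemma theta0 p : theta p 0 = 0.
Proof. by rewrite /theta /dmap /vder derive0 /fcomp mul0mx. Qed.

Lemma thetaZ p a u : theta p (a *: u) = a *: theta p u.
Proof. by rewrite -[a *: u]addr0 theta_lin theta0 addr0. Qed.

Lemma thetaD p u v : theta p (u + v) = theta p u + theta p v.
Proof. by rewrite -[u]scale1r theta_lin !scale1r. Qed.

Lemma thetaB p u v : theta p (u - v) = theta p u - theta p v.
Proof. by rewrite thetaD -scaleN1r thetaZ scaleN1r. Qed.

Lemma theta_sum (I : Type) (r : seq I) (f : I -> 'rV[R]_n) p :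
  theta p (\sum_(i <- r) f i) = \sum_(i <- r) theta p (f i).
Proof.
elim: r => [|i r IH]; first by rewrite !big_nil theta0.
by rewrite !big_cons thetaD IH.
Qed.

Lemma theta_inj p v : theta p v = 0 -> v = 0.
Proof.
move=> h; case: emb => _ /(_ p) inj _ _; apply: inj.
exact: (@fcomp_inj _ _ _ (iota p) _ _ (etrans h (esym (theta0 p)))).
Qed.

Lemma smooth_comp_iota m (O : set Mt) (f : Mt -> 'rV[R]_m) : open O -> smooth_on O f ->
  smooth_on (iota @^-1` O) (f \o iota).
Proof.
move=> oO sf; apply: smooth_local => p Op.
set c' := iota p; have oc := chdom_open c'.
have oV : open (iota @^-1` (chdom c' `&` O)) by apply: iota_preimage_open; exact: openI.
exists (iota @^-1` (chdom c' `&` O)); first by split => //; exact: chdom_center.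
move=> c k; have oi := chart_image_open c oV.
have c1 : Ck k (chart c @` (chdom c `&` iota @^-1` (chdom c' `&` O)))
    ((chart c' \o iota) \o chinv c).
  apply: (Ck_sub _ (iota_chart_smooth c' c k)) => y [q [cq [c'q Oq]] <-].
  exact: (mem_chart_image (U := iota @^-1` chdom c') cq c'q).
have := Ck_comp_row oi (chart_image_open c' oO) _ c1 (sf c' k).
move=> h; apply: (Ck_congr oi _ (h _)) => y [q [cq [c'q Oq]] <-] /=; rewrite (chartK cq).
  by rewrite (chartK c'q).
exact: (mem_chart_image (U := O) c'q Oq).
Qed.

(** Near [p] both [dmap iota] and the parallel frame are expressed in the fixed chart
    of index [iota p]. *)
Lemma theta_smooth U X : open U -> smooth_field U X ->
  smooth_on U (fun p => theta p (X p)).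
Proof.
move=> oU sX; apply: smooth_local => p Up.
set c' := iota p; pose U' := U `&` iota @^-1` chdom c'.
have oc := chdom_open c'.
have oU' : open U' by apply: openI => //; exact: iota_preimage_open.
exists U'; first by split => //; exact: chdom_center.
have sX' : smooth_field U' X by apply: smooth_field_sub sX => q [].
have s1 : smooth_on U' (fun q => vder (chart c' \o iota) q (X q)).
  apply: smooth_vder_row => //.
  by apply: smooth_sub (iota_chart_smooth c') => q [].
pose A q := \matrix_i field_in_chart (wframe i) c' (iota q).
have uA q : U' q -> A q \in unitmx by move=> [_ /(fcomp_chart 0) []].
have sA i j : smooth_on U' (fun q => A q i j).
  have s2 : smooth_on U' (field_in_chart (wframe i) c' \o iota).
    apply: smooth_sub (smooth_comp_iota oc _); first by move=> q [].
    have := @wframe_smooth _ _ Mt i c'; rewrite setTI; exact.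
  by apply: smooth_congr (smooth_coord j oU' s2) => // q _; rewrite /A mxE.
have := smooth_mulmx oU' s1 (smooth_invmx oU' uA sA).
apply: smooth_congr => // q [Uq cq].
by rewrite /theta (fcomp_chart _ cq).1 dmap_chart.
Qed.

(** The Gram-Schmidt process applied to the coordinate frame of [c].  The first [k]
    fields obtained have no component along the coordinate directions of index at
    least [k]; hence the next field has component 1 in the direction [k] before it is
    normalized, and does not vanish. *)
Lemma gram_schmidt (c : M) : exists e : 'I_n -> M -> 'rV[R]_n,
  orthonormal_frame iota (chdom c) e.
Proof.
have oc := chdom_open c.
suff H k : (k <= n)%N -> exists e : nat -> M -> 'rV[R]_n,
  [/\ forall i, smooth_field (chdom c) (e i),
      forall q, chdom c q -> forall i (a : 'I_n), (i < k <= a)%N ->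
         vder (chart c) q (e i q) ord0 a = 0 &
      forall q, chdom c q -> forall i j, (i < k)%N -> (j < k)%N ->
         dot (theta q (e i q)) (theta q (e j q)) = (i == j)%:R].
  have [e [se _ oe]] := H n (leqnn n).
  exists (fun i => e i); split=> [i|p cp i j]; first exact: se.
  exact: oe.
elim: k => [_|k IH kn].
  exists (fun _ _ => 0); split => // i; exact: smooth_field0.
have [e [se te oe]] := IH (ltnW kn).
pose a := Ordinal kn.
have [X [sX cX]] : exists X, smooth_field (chdom c) X /\
    forall q, chdom c q -> vder (chart c) q (X q) = delta_mx ord0 a.
  exists (coord_field c a); split; first exact: coord_field_smooth.
  exact: coord_field_id.
have [g gE] : exists g, forall i q, g i q = dot (theta q (X q)) (theta q (e i q)).
  by exists (fun i q => dot (theta q (X q)) (theta q (e i q))).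
have sg i : smooth_on (chdom c) (fun q => - g i q).
  apply: smooth_congr oc _ (smoothN oc (smooth_dot oc (theta_smooth oc sX) (theta_smooth oc (se i)))).
  by move=> q _; rewrite gE.
pose Y q := 1 *: X q + \sum_(i < k) - g i q *: e i q.
have sY : smooth_field (chdom c) Y.
  apply: (smooth_field_scaleD oc (smooth_cst _ _) sX).
  by apply: (smooth_field_sum (f := fun (i : 'I_k) q => - g i q) (X := fun i => e i) _ oc) => i;
    [exact: sg|exact: se].
have cY q (b : 'I_n) : chdom c q -> (k <= b)%N ->
    vder (chart c) q (Y q) ord0 b = (b == a)%:R.
  move=> cq kb; have qq := chdom_center q.
  have dc := chart_diff qq cq.
  rewrite /Y vder_chart_linear// mxE mxE cX// mxE eqxx /=.
  suff -> : vder (chart c) q (\sum_(i < k) - g i q *: e i q) ord0 b = 0.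
    by rewrite mul1r addr0.
  rewrite /vder deriveE// linear_sum summxE big1// => i _.
  by rewrite linearZ mxE -deriveE// -/(vder _ _ _) te ?mulr0// ltn_ord.
have Y0 q : chdom c q -> 0 < dot (theta q (Y q)) (theta q (Y q)).
  move=> cq; apply: dot_gt0; apply/eqP => /theta_inj Yq0.
  have := cY q a cq (leqnn k); rewrite eqxx Yq0 /vder derive0 mxE => /esym/eqP.
  by rewrite oner_eq0.
have YE q j : chdom c q -> (j < k)%N -> dot (theta q (Y q)) (theta q (e j q)) = 0.
  move=> cq jk.
  have -> : theta q (Y q) = theta q (X q) + \sum_(i < k)
      - dot (theta q (X q)) (theta q (e i q)) *: theta q (e i q).
    rewrite /Y theta_lin theta_sum scale1r; congr (_ + _).
    by apply: eq_bigr => i _; rewrite thetaZ gE.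
  apply: (@gram_schmidt_orth _ _ _ _ (fun i : 'I_k => theta q (e i q)) (Ordinal jk)).
  by move=> i l; exact: oe.
pose rr q := (Num.sqrt (dot (theta q (Y q)) (theta q (Y q))))^-1.
have srr : smooth_on (chdom c) rr.
  apply: smoothV => // [q cq|]; first by rewrite gt_eqF// sqrtr_gt0 Y0.
  by apply: smooth_sqrt => //; apply: smooth_dot => //; exact: theta_smooth.
pose Z q := rr q *: Y q + 0.
have sZ : smooth_field (chdom c) Z.
  exact: (smooth_field_scaleD oc srr sY (smooth_field0 oc)).
have ZE q : theta q (Z q) = rr q *: theta q (Y q) by rewrite /Z addr0 thetaZ.
exists (fun i => if i == k then Z else e i); split.
- by move=> i; case: (i == k); [exact: sZ|exact: se].
- move=> q cq i b /andP[ik kb]; case: eqP => [_|/eqP ik'].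
    have dc := chart_diff (chdom_center q) cq.
    rewrite /Z /vder addr0 deriveE// linearZ mxE -deriveE// -/(vder _ _ _) cY ?(ltnW kb)//.
    by rewrite -val_eqE /= gtn_eqF// mulr0.
  by apply: te => //; rewrite (ltnW kb) andbT ltn_neqAle ik'.
- move=> q cq i j; rewrite !ltnS => ik jk.
  have E1 : rr q * (rr q * dot (theta q (Y q)) (theta q (Y q))) = 1.
    rewrite mulrA -expr2 /rr exprVn sqr_sqrtr; last exact/ltW/Y0.
    by rewrite mulVf// gt_eqF// Y0.
  case: (altP (i =P k)) => [->|ik']; case: (altP (j =P k)) => [->|jk'].
  + by rewrite eqxx ZE dotZl dotZr E1.
  + have jk2 : (j < k)%N by rewrite ltn_neqAle jk' jk.
    by rewrite ZE dotZl YE// mulr0 eq_sym (negPf jk').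
  + have ik2 : (i < k)%N by rewrite ltn_neqAle ik' ik.
    by rewrite ZE dotZr dotC YE// mulr0 (negPf ik').
  + by apply: oe => //; rewrite ltn_neqAle ?ik' ?jk'.
Qed.

End Theta.

(** * Tangential part and adjoint *)

Section Pointwise.
Variables (R : realType) (n : nat) (M : smoothManifold R n).
Variables (Mt : weitzenbock R n.+1) (iota : M -> Mt).
Hypothesis emb : smooth_embedding iota.
Implicit Types (p q : M).

Definition theta_mx p : 'M[R]_(n, n.+1) :=
  jacobian (chart (iota p) \o iota \o chinv p) (chart p p)
    *m invmx (\matrix_i wframe i (iota p)).

Lemma theta_mxE p v : theta iota p v = v *m theta_mx p.
Proof.
rewrite /theta /fcomp /dmap /vder /theta_mx mulmxA; congr (_ *m _).
exact: deriveEjacobian (iota_diff emb p).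
Qed.

Variables (p : M) (e : 'I_n -> 'rV[R]_n).
Hypothesis oe : forall i j, dot (theta iota p (e i)) (theta iota p (e j)) = (i == j)%:R.

Lemma theta_expand v : v = \sum_i dot (theta iota p v) (theta iota p (e i)) *: e i.
Proof.
have oe' i j : dot (e i *m theta_mx p) (e j *m theta_mx p) = (i == j)%:R.
  by rewrite -!theta_mxE oe.
by rewrite {1}(frame_expand oe' v); apply: eq_bigr => i _; rewrite !theta_mxE.
Qed.

Lemma theta_frame v :
  theta iota p v = \sum_i dot (theta iota p v) (theta iota p (e i)) *: theta iota p (e i).
Proof.
rewrite {1}(theta_expand v) theta_sum//.
by apply: eq_bigr => i _; rewrite thetaZ.
Qed.

(** The orthogonal projection, written in an orthonormal frame, is a vector with the
    property that defines [tangential], so the choice made there is meaningful. *)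
Lemma tangentialE w u :
  dot (theta iota p (tangential iota p w)) (theta iota p u) =
  dot (fcomp (iota p) w) (theta iota p u).
Proof.
have [z Hz] : exists z, forall u,
    wmetric (iota p) (w - dmap iota p z) (dmap iota p u) = 0.
  exists (\sum_i dot (fcomp (iota p) w) (theta iota p (e i)) *: e i) => u'.
  transitivity (dot (fcomp (iota p) w) (theta iota p u') -
      dot (\sum_i dot (fcomp (iota p) w) (theta iota p (e i)) *: theta iota p (e i))
          (theta iota p u')); last exact/frame_project/theta_frame.
  rewrite /wmetric fcompB dotBl; congr (_ - dot _ _).
  apply: (etrans (theta_sum emb _ _ _)); apply: eq_bigr => i _; exact: thetaZ.
have := @xgetPex _ 0 [set z : 'rV[R]_n |
    forall u, wmetric (iota p) (w - dmap iota p z) (dmap iota p u) = 0] (ex_intro _ z Hz).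
move=> /(_ u) /=; rewrite /wmetric fcompB dotBl => /eqP; rewrite subr_eq0 => /eqP.
by move=> ->.
Qed.

(** In an orthonormal basis the adjoint is the transpose; this gives a matrix with the
    property that defines [adjoint]. *)
Lemma adjointE (A : M -> 'M[R]_n) u v :
  dot (theta iota p (u *m adjoint iota A p)) (theta iota p v) =
  dot (theta iota p u) (theta iota p (v *m A p)).
Proof.
pose T := theta_mx p.
pose E := \matrix_i e i.
have [G GE] : exists G, G = T *m T^T by exists (T *m T^T).
have dotG (x y : 'rV[R]_n) : dot (theta iota p x) (theta iota p y) =
    (x *m G *m y^T) ord0 ord0.
  by rewrite !theta_mxE GE mulmxA -mulmxA -trmx_mul dot_mx !row_id.
have EGE : (E *m G) *m E^T = 1%:M.
  apply/matrixP => i j; rewrite GE mulmxA -mulmxA -trmx_mul dot_mx !row_mul !rowK.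
  by rewrite -!theta_mxE oe mxE; case: eqP.
have [B' HB] : exists B : 'M[R]_n, forall u v,
    induced_metric iota p (u *m B) v = induced_metric iota p u (v *m A p).
  (* [G] is the Gram matrix of the metric and [E^T *m E] its inverse. *)
  exists (G *m (A p)^T *m E^T *m E) => u' v'.
  apply: (etrans (dotG _ _)); apply: (etrans _ (esym (dotG _ _))); rewrite trmx_mul.
  congr (fun_of_matrix _ ord0 ord0); rewrite -!mulmxA; congr (_ *m (_ *m _)).
  have -> : E^T *m (E *m (G *m v'^T)) = (E^T *m (E *m G)) *m v'^T by rewrite !mulmxA.
  by rewrite (mulmx1C EGE) mul1mx.
exact: (@xgetPex _ 0 [set B : 'M[R]_n | forall u v,
    induced_metric iota p (u *m B) v = induced_metric iota p u (v *m A p)] (ex_intro _ B' HB)).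
Qed.

End Pointwise.

Section Structure.
Variables (R : realType) (n : nat) (M : smoothManifold R n).
Variables (Mt : weitzenbock R n.+1) (iota : M -> Mt).
Hypothesis emb : smooth_embedding iota.

Lemma ambientE (U : set M) Y p v : open U -> smooth_field U Y -> U p ->
  fcomp (iota p) (ambient_cov iota Y p v) = vder (fun x => theta iota x (Y x)) p v.
Proof.
move=> oU sY Up.
have df := smooth_diff (theta_smooth emb oU sY) (chdom_center p) Up.
rewrite /ambient_cov /wcov.
under eq_bigr do rewrite (@vder_coord _ _ _ _ (fun x => theta iota x (Y x)))//.
exact: fcomp_frame.
Qed.

End Structure.

(** * Structure equations and the Laplacian of a height function *)

(** Here [h i j] stands for $<W e_i, e_j>$, [G i j k] for $<nabla_{e_i} e_j, e_k>$ and
    [Dh i j k] for the derivative of [h j k] along [e_i].  The second hypothesis is the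
    Codazzi equation; contracting its first and last indices gives $div W^t = grad H$, hence
    $div (H I + W - W^t) = div W$.  The third hypothesis says that the left-hand side
    vanishes, the conclusion that $div W$ does. *)
Lemma divergence_algebra (R : comRingType) (n : nat) (h : 'I_n -> 'I_n -> R)
   (G Dh : 'I_n -> 'I_n -> 'I_n -> R) :
  (forall i j k, G i j k = - G i k j) ->
  (forall i j k, (Dh j i k + \sum_l h i l * G j l k) - (Dh i j k + \sum_l h j l * G i l k)
      = - \sum_l (G i j l - G j i l) * h l k) ->
  (forall k, \sum_i ((((i == k)%:R * \sum_l Dh i l l + Dh i i k - Dh i k i)
      + \sum_j ((i == j)%:R * (\sum_l h l l) + h i j - h j i) * G i j k)
      - \sum_j G i i j * ((j == k)%:R * (\sum_l h l l) + h j k - h k j)) = 0) ->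
  forall k, \sum_i (Dh i i k + \sum_j h i j * G i j k - \sum_j G i i j * h j k) = 0.
Proof.
move=> GA C D k; rewrite -[RHS](D k); apply/eqP; rewrite -subr_eq0 -sumrB; apply/eqP.
set H := \sum_l h l l.
transitivity (\sum_i \sum_l (h i l * G k l i - h l i * G k i l)); last first.
  under eq_bigr do rewrite sumrB.
  by rewrite sumrB [X in _ - X]exchange_big subrr.
have pick (i : 'I_n) (F : 'I_n -> R) : \sum_j (i == j)%:R * F j = F i.
  rewrite (bigD1 i)//= eqxx mul1r big1 ?addr0// => j; rewrite eq_sym => /negPf ->.
  by rewrite mul0r.
have ddE : \sum_i (i == k)%:R * \sum_l Dh i l l = \sum_i Dh k i i.
  by under eq_bigr do rewrite eq_sym; rewrite pick.
apply/eqP; rewrite -subr_eq0; apply/eqP.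
transitivity (\sum_i Dh k i i - \sum_i (i == k)%:R * \sum_l Dh i l l); last first.
  by rewrite ddE subrr.
rewrite -!sumrB; apply: eq_bigr => i _.
have := C i k i.
have -> : \sum_j ((i == j)%:R * H + h i j - h j i) * G i j k =
   H * G i i k + \sum_j h i j * G i j k - \sum_j h j i * G i j k.
  rewrite -(pick i (fun j => H * G i j k)) -big_split -sumrB; apply: eq_bigr => j _ /=; ring.
have -> : \sum_j G i i j * ((j == k)%:R * H + h j k - h k j) =
   H * G i i k + \sum_j G i i j * h j k - \sum_j G i i j * h k j.
  rewrite -(pick k (fun j => H * G i i j)) -big_split -sumrB; apply: eq_bigr => j _ /=.
  rewrite (eq_sym j k); ring.
have -> : \sum_l h k l * G i l i = - \sum_l G i i l * h k l.
  by rewrite -sumrN; apply: eq_bigr => l _; rewrite (GA i l i); ring.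
have -> : \sum_l (G i k l - G k i l) * h l i =
    - \sum_l h l i * G i l k - \sum_l h l i * G k i l.
  by rewrite -sumrN -sumrB; apply: eq_bigr => l _; rewrite (GA i k l); ring.
rewrite sumrB.
move: (\sum_l h i l * G k l i) (\sum_l h l i * G k i l) => x y E.
have -> : x = - Dh k i i + (Dh i k i - \sum_l G i i l * h k l)
    + \sum_l h l i * G i l k + y.
  have -> : x = (Dh k i i + x - (Dh i k i + - (\sum_l G i i l * h k l)))
     - Dh k i i + (Dh i k i - \sum_l G i i l * h k l) by ring.
  by rewrite E; ring.
ring.
Qed.

(** The form taken by [vder2_height] at a point where the fixed vector is the [k]-th
    vector of the frame: [x] and [y] are the components of its opposite. *)
Lemma contract_frame (R : comPzRingType) (n : nat) (a c f x : 'I_n -> R)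
    (g : 'I_n -> 'I_n -> R) (y : R) k :
  (forall l, x l = - (l == k)%:R) -> y = 0 ->
  \sum_l (a l * x l + c l * (\sum_m g l m * x m + f l * y)) =
  - (a k + \sum_l c l * g l k).
Proof.
move=> xE y0.
have pick (F : 'I_n -> R) : \sum_l F l * x l = - F k.
  by rewrite -(sum_mul_delta F k) -sumrN; apply: eq_bigr => l _; rewrite xE mulrN.
rewrite big_split /= pick opprD -sumrN; congr (_ + _).
by apply: eq_bigr => l _; rewrite pick y0 mulr0 addr0 mulrN.
Qed.

(** In the application [t i] is the image of [e i] under [theta], and [nu] is the Gauss
    map of the hypersurface. *)
Section MovingFrame.
Variables (R : realType) (n : nat) (M : smoothManifold R n) (U : set M).
Variables (e : 'I_n -> M -> 'rV[R]_n) (t : 'I_n -> M -> 'rV[R]_n.+1) (nu : M -> 'rV[R]_n.+1).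
Hypothesis oU : open U.
Hypothesis se : forall i, smooth_field U (e i).
Hypothesis st : forall i, smooth_on U (t i).
Hypothesis snu : smooth_on U nu.
Hypothesis tt : forall q, U q -> forall i j, dot (t i q) (t j q) = (i == j)%:R.
Hypothesis nt : forall q, U q -> forall i, dot (nu q) (t i q) = 0.
Hypothesis nn : forall q, U q -> dot (nu q) (nu q) = 1.

(** The matrix of the Weingarten map: [second_form i j] is $<W e_i, e_j>$. *)
Definition second_form i j q : R := - dot (vder nu q (e i q)) (t j q).

(** The coefficients of the induced connection, $<nabla_{e_i} e_j, e_k>$. *)
Definition connection_form i j k q : R := dot (vder (t j) q (e i q)) (t k q).
Notation h := second_form.
Notation G := connection_form.

Lemma smooth_second_form i j : smooth_on U (h i j).
Proof. exact: (smoothN oU (smooth_dot oU (smooth_vder_row oU (se i) snu) (st j))). Qed.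

Lemma smooth_connection_form i j k : smooth_on U (G i j k).
Proof. exact: (smooth_dot oU (smooth_vder_row oU (se i) (st j)) (st k)). Qed.

Lemma vder_dot_const (f g : M -> 'rV[R]_n.+1) (a : R) q v : smooth_on U f -> smooth_on U g ->
  U q -> (forall z, U z -> dot (f z) (g z) = a) ->
  dot (vder f q v) (g q) = - dot (f q) (vder g q v).
Proof.
move=> sf sg Uq fg; apply/eqP; rewrite -addr_eq0 -(vder_dot v sf sg Uq).
by rewrite (vder_congr (g := fun=> a) v oU Uq fg) vder_cst.
Qed.

Lemma connection_antisym q i j k : U q -> G i j k q = - G i k j q.
Proof.
move=> Uq; rewrite /G (vder_dot_const (e i q) (st j) (st k) Uq (fun z Uz => tt Uz j k)).
by rewrite dotC.
Qed.

Lemma second_form_dual q i j : U q -> dot (vder (t j) q (e i q)) (nu q) = h i j q.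
Proof.
move=> Uq; rewrite /h (vder_dot_const (e i q) snu (st j) Uq (fun z Uz => nt Uz j)).
by rewrite opprK dotC.
Qed.

Lemma vder_nu q i : U q -> vder nu q (e i q) = \sum_j - h i j q *: t j q.
Proof.
move=> Uq.
rewrite [LHS](frame_complete (tt Uq) (nt Uq) (nn Uq)).
have -> : dot (vder nu q (e i q)) (nu q) = 0.
  have E := vder_dot_const (e i q) snu snu Uq nn.
  have gen (x : R) : x = - x -> x = 0 by move=> ?; lra.
  by apply: gen; rewrite {1}E dotC.
by rewrite scale0r addr0; apply: eq_bigr => j _; rewrite /h opprK.
Qed.

Lemma vder_t q i j : U q ->
  vder (t j) q (e i q) = \sum_k G i j k q *: t k q + h i j q *: nu q.
Proof.
move=> Uq; rewrite [LHS](frame_complete (tt Uq) (nt Uq) (nn Uq)).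
by rewrite second_form_dual.
Qed.

Lemma vder_dot_cst (f : M -> 'rV[R]_n.+1) V q v : smooth_on U f -> U q ->
  vder (fun z => dot (f z) V) q v = dot (vder f q v) V.
Proof.
move=> sf Uq; rewrite (vder_dot v sf (smooth_cst U V) Uq).
by rewrite vder_cst dot0r addr0.
Qed.

Lemma height_smooth V : smooth_on U (fun z => dot (nu z) V).
Proof. exact: (smooth_dot oU snu (smooth_cst U V)). Qed.

Lemma vder_height V q i : U q ->
  vder (fun z => dot (nu z) V) q (e i q) = \sum_l h i l q * dot (t l q) (- V).
Proof.
move=> Uq; rewrite (vder_dot_cst V _ snu Uq) vder_nu// dot_suml.
by apply: eq_bigr => l _; rewrite dotZl dotNr mulNr mulrN.
Qed.

(** Derivatives of the height $nu . V$ are taken with the Weingarten formula [vder_nu],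
    those of the [t l] that appear with the Gauss formula [vder_t]. *)
Lemma vder2_height V p i j : U p ->
  vder (fun q => vder (fun z => dot (nu z) V) q (e j q)) p (e i p) =
  \sum_l (vder (h j l) p (e i p) * dot (t l p) (- V)
    + h j l p * (\sum_k G i l k p * dot (t k p) (- V) + h i l p * dot (nu p) (- V))).
Proof.
move=> Up.
rewrite (vder_congr (g := fun q => \sum_l h j l q * dot (t l q) (- V)) _ oU Up); last first.
  by move=> z Uz; exact: vder_height.
have sl l : smooth_on U (fun q => dot (t l q) (- V)).
  exact: (smooth_dot oU (st l) (smooth_cst U (- V))).
have sm l : smooth_on U (fun q => h j l q * dot (t l q) (- V)).
  exact: (smoothM oU (smooth_second_form j l) (sl l)).
rewrite (vder_sum _ _ oU sm Up); apply: eq_bigr => l _.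
rewrite (vderM _ (smooth_second_form j l) (sl l) Up); congr (_ + _ * _).
rewrite (vder_dot_cst (- V) _ (st l) Up) vder_t// dotDl dot_suml dotZl; congr (_ + _).
by apply: eq_bigr => k _; rewrite dotZl.
Qed.

(** The hypothesis is the vanishing of the torsion.  The equation is the identity
    $[e_i, e_j] f = e_i (e_j f) - e_j (e_i f)$ for the height $f = nu . V$, where the
    fixed vector $V$ is the value of [t k] at [p]. *)
Lemma codazzi p i j k : U p ->
  bracket (e i) (e j) p = \sum_l (G i j l p - G j i l p) *: e l p ->
  (vder (h i k) p (e j p) + \sum_l h i l p * G j l k p)
    - (vder (h j k) p (e i p) + \sum_l h j l p * G i l k p)
  = - \sum_l (G i j l p - G j i l p) * h l k p.
Proof.
move=> Up br.
pose V := t k p.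
have tV l : dot (t l p) (- V) = - (l == k)%:R by rewrite dotNr /V tt.
have nV : dot (nu p) (- V) = 0 by rewrite dotNr /V nt// oppr0.
have D2 a b : vder (fun q => vder (fun z => dot (nu z) V) q (e b q)) p (e a p) =
    - (vder (h b k) p (e a p) + \sum_l h b l p * G a l k p).
  exact: (etrans (vder2_height V a b Up) (contract_frame _ _ _ _ tV nV)).
have df := smooth_diff (height_smooth V) (chdom_center p) Up.
have := vder_bracket oU Up (height_smooth V) (se i) (se j).
rewrite !D2 br.
have -> : vder (fun z => dot (nu z) V) p (\sum_l (G i j l p - G j i l p) *: e l p) =
   \sum_l (G i j l p - G j i l p) * vder (fun z => dot (nu z) V) p (e l p).
  pose f := vder (fun z => dot (nu z) V) p.
  pose fl := GRing.isLinear.Build _ _ _ _ f (vder_linear df).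
  pose F : {linear 'rV[R]_n -> R} := HB.pack f fl.
  rewrite -[LHS]/(F _) linear_sum; apply: eq_bigr => l _; rewrite linearZ; exact: erefl.
move=> E; rewrite opprK addrC in E; rewrite -E -sumrN; apply: eq_bigr => l _.
rewrite vder_height//; under eq_bigr do rewrite tV mulrN.
by rewrite sumrN (sum_mul_delta (fun l' => h l l' p)) mulrN.
Qed.

(** By [vder2_height] the Laplacian of $nu . V$ is $- V . theta (div W)$ plus the
    contribution of the normal parts of the derivatives of the [t l], which is
    $- (nu . V) |W|^2$.  The hypothesis is $div W = 0$. *)
Lemma laplacian_height V p : U p ->
  (forall k, \sum_i (vder (h i k) p (e i p) + \sum_j h i j p * G i j k p
     - \sum_j G i i j p * h j k p) = 0) ->
  \sum_i (vder (fun q => vder (fun z => dot (nu z) V) q (e i q)) p (e i p)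
    - \sum_j G i i j p * vder (fun z => dot (nu z) V) p (e j p)) =
  - dot (nu p) V * \sum_i \sum_j (h i j p) ^+ 2.
Proof.
move=> Up B.
transitivity (\sum_i (\sum_k dot (t k p) (- V) *
   (vder (h i k) p (e i p) + \sum_j h i j p * G i j k p
     - \sum_j G i i j p * h j k p) + dot (nu p) (- V) * \sum_j (h i j p) ^+ 2)); last first.
  rewrite big_split /= exchange_big /= big1 ?add0r => [|k _].
    by rewrite mulr_sumr dotNr.
  by rewrite -mulr_sumr B mulr0.
apply: eq_bigr => i _; rewrite vder2_height//.
under [X in _ - X]eq_bigr do rewrite vder_height//.
have -> : \sum_j G i i j p * (\sum_l h j l p * dot (t l p) (- V)) =
   \sum_k dot (t k p) (- V) * \sum_j G i i j p * h j k p.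
  under eq_bigr do rewrite mulr_sumr.
  rewrite exchange_big /=; apply: eq_bigr => k _; rewrite mulr_sumr.
  by apply: eq_bigr => j _; ring.
have -> : \sum_l (vder (h i l) p (e i p) * dot (t l p) (- V)
    + h i l p * (\sum_k G i l k p * dot (t k p) (- V) + h i l p * dot (nu p) (- V))) =
  \sum_k dot (t k p) (- V) * (vder (h i k) p (e i p) + \sum_j h i j p * G i j k p)
  + dot (nu p) (- V) * \sum_j (h i j p) ^+ 2.
  under eq_bigr do rewrite mulrDr.
  rewrite !big_split /=.
  under [X in _ = X + _]eq_bigr do rewrite mulrDr.
  rewrite big_split /= -addrA; congr (_ + (_ + _)).
  - by apply: eq_bigr => l _; rewrite mulrC.
  - under eq_bigr do rewrite mulr_sumr.
    rewrite exchange_big /=; apply: eq_bigr => k _; rewrite mulr_sumr.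
    by apply: eq_bigr => j _; ring.
  - by rewrite mulr_sumr; apply: eq_bigr => j _; ring.
rewrite addrAC -sumrB; congr (_ + _); apply: eq_bigr => k _.
by rewrite -mulrBr.
Qed.

End MovingFrame.

Section Geometry.
Variables (R : realType) (n : nat) (Mt : weitzenbock R n.+1) (M : smoothManifold R n).
Variables (o : orientation M) (iota : M -> Mt) (N : M -> 'rV[R]_n.+1) (W : M -> 'M[R]_n).
Hypothesis emb : smooth_embedding iota.
Hypothesis N_normal : is_unit_normal iota o N.
Hypothesis wein : is_weingarten iota N W.
Hypothesis tf : torsion_free iota.
Hypothesis div0 : divergence_free iota
      (fun p => (\tr (W p))%:M + 2 *: antisym_part iota W p).
Variables (U : set M) (e : 'I_n -> M -> 'rV[R]_n).
Hypothesis oU : open U.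
Hypothesis fe : orthonormal_frame iota U e.

Let se i : smooth_field U (e i). Proof. by case: fe. Qed.
Let t i q := theta iota q (e i q).
Let nu := gauss_map iota N.

Lemma gauss_smooth : smooth_on setT nu.
Proof. by case: N_normal. Qed.

Lemma gauss_smooth_on : smooth_on U nu.
Proof. exact: smooth_sub gauss_smooth. Qed.

Lemma frame_image_smooth i : smooth_on U (t i).
Proof. exact: theta_smooth. Qed.

Lemma frame_gram q : U q -> forall i j, dot (t i q) (t j q) = (i == j)%:R.
Proof. by move=> Uq i j; case: fe => _ /(_ q Uq i j). Qed.

Lemma gauss_orthogonal q v : dot (nu q) (theta iota q v) = 0.
Proof. by case: N_normal => _ /(_ q) [_ /(_ v)]. Qed.

Lemma gauss_unit q : dot (nu q) (nu q) = 1.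
Proof. by case: N_normal => _ /(_ q) []. Qed.

Notation h := (second_form e t nu).
Notation G := (connection_form e t).

Lemma dot_nabla Y p v k : smooth_field U Y -> U p ->
  dot (theta iota p (nabla iota Y p v)) (t k p) =
  dot (vder (fun x => theta iota x (Y x)) p v) (t k p).
Proof.
move=> sY Up; rewrite /nabla (tangentialE emb (frame_gram Up)).
by rewrite (ambientE emb _ oU sY Up).
Qed.

Lemma nablaE p i j : U p -> nabla iota (e j) p (e i p) = \sum_k G i j k p *: e k p.
Proof.
move=> Up; rewrite [LHS](theta_expand emb (frame_gram Up)); apply: eq_bigr => k _.
by rewrite -/(t k p) (dot_nabla _ _ (se j) Up).
Qed.

Lemma bracketE p i j : U p ->
  bracket (e i) (e j) p = \sum_l (G i j l p - G j i l p) *: e l p.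
Proof.
move=> Up; have := tf oU (se i) (se j) Up => /eqP; rewrite subr_eq0 => /eqP <-.
by rewrite !nablaE// -sumrB; apply: eq_bigr => l _; rewrite scalerBl.
Qed.

Lemma weingartenE q i j : U q -> dot (theta iota q (e i q *m W q)) (t j q) = h i j q.
Proof.
move=> Uq; have ntU z (_ : U z) k : dot (nu z) (t k z) = 0 by exact: gauss_orthogonal.
rewrite -(second_form_dual e oU frame_image_smooth gauss_smooth_on ntU i j Uq) dotC.
transitivity (dot (nu q) (fcomp (iota q) (ambient_cov iota (e j) q (e i q)))).
  rewrite dotC; exact: (wein oU (se j) (e i q) Uq).
by rewrite dotC (ambientE emb _ oU (se j) Uq).
Qed.

(** The trace is computed in the orthonormal basis [e]: [EGE] inverts the matrix of [e]. *)
Lemma trace_W q : U q -> \tr (W q) = \sum_l h l l q.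
Proof.
move=> Uq; pose E := \matrix_i e i q; pose T := theta_mx iota q.
have EGE : E *m (T *m (E *m T)^T) = 1%:M.
  apply/matrixP => i j; rewrite mulmxA dot_mx !row_mul !rowK -!(theta_mxE emb) mxE.
  by rewrite (frame_gram Uq); case: eqP.
have -> : \tr (W q) = \tr ((E *m W q *m T) *m (E *m T)^T).
  rewrite -{1}[W q]mulmx1 -(mulmx1C EGE).
  have -> : W q *m (T *m (E *m T)^T *m E) = (W q *m T *m (E *m T)^T) *m E by rewrite !mulmxA.
  by rewrite mxtrace_mulC !mulmxA.
apply: eq_bigr => i _.
by rewrite dot_mx !row_mul !rowK -!(theta_mxE emb) -weingartenE.
Qed.

Let A p := (\tr (W p))%:M + 2 *: antisym_part iota W p.

(** The matrix of $H I + 2 W^a = H I + W - W^t$ in the frame. *)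
Definition div_coef i j q := (i == j)%:R * (\sum_l h l l q) + h i j q - h j i q.

Lemma div_tensor_coefE q i j : U q -> dot (theta iota q (e i q *m A q)) (t j q) = div_coef i j q.
Proof.
move=> Uq; rewrite /A /antisym_part scalerA divff ?pnatr_eq0// scale1r.
rewrite mulmxDr mul_mx_scalar mulmxBr theta_lin// thetaB// dotDl dotZl dotBl.
transitivity (\tr (W q) * (i == j)%:R + (h i j q - h j i q)).
  congr (_ * _ + (_ - _)); [exact: frame_gram|exact: weingartenE|].
  apply: (etrans (adjointE emb (frame_gram Uq) W (e i q) (e j q))).
  by apply: (etrans (dotC _ _)); exact: weingartenE.
by rewrite trace_W// addrA mulrC.
Qed.

Lemma div_tensor_expand q i : U q -> theta iota q (e i q *m A q) = \sum_j div_coef i j q *: t j q.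
Proof.
move=> Uq; rewrite [e i q *m A q](theta_expand emb (frame_gram Uq)) theta_sum//.
by apply: eq_bigr => j _; rewrite thetaZ// div_tensor_coefE.
Qed.

Lemma shape_smooth i j : smooth_on U (h i j).
Proof. exact (smooth_second_form oU se frame_image_smooth gauss_smooth_on i j). Qed.

Lemma mean_curvature_smooth : smooth_on U (fun q => \sum_l h l l q).
Proof. by apply: smooth_sum => // l; exact: shape_smooth. Qed.

Lemma div_coef_smooth i j : smooth_on U (div_coef i j).
Proof.
apply: (smoothB oU _ (shape_smooth j i)); apply: (smoothD oU _ (shape_smooth i j)).
exact: (smoothM oU (smooth_cst U _) mean_curvature_smooth).
Qed.

Lemma div_tensor_field_smooth i : smooth_field U (fun x => e i x *m A x).
Proof.
apply: (@smooth_field_congr _ _ _ _ (fun x => \sum_j div_coef i j x *: e j x)) => //.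
  move=> q Uq; rewrite [RHS](theta_expand emb (frame_gram Uq)).
  by apply: eq_bigr => j _; rewrite div_tensor_coefE.
by apply: smooth_field_sum => // j; [exact: div_coef_smooth].
Qed.

Lemma vder_div_coef p i k v : U p -> vder (div_coef i k) p v =
  (i == k)%:R * (\sum_l vder (h l l) p v) + vder (h i k) p v - vder (h k i) p v.
Proof.
move=> Up.
have s1 : smooth_on U (fun q => (i == k)%:R * \sum_l h l l q).
  exact: (smoothM oU (smooth_cst U _) mean_curvature_smooth).
have s2 := smoothD oU s1 (shape_smooth i k).
have s3 : smooth_on U (fun q => -1 * h k i q).
  exact: (smoothM oU (smooth_cst U _) (shape_smooth k i)).
rewrite (vder_congr (g := fun q => (i == k)%:R * (\sum_l h l l q) + h i k q + -1 * h k i q)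
   _ oU Up); last by move=> q _; rewrite mulN1r.
apply: (etrans (vderD v s2 s3 Up)); congr (_ + _).
  apply: (etrans (vderD v s1 (shape_smooth i k) Up)); congr (_ + _).
  apply: (etrans (vderM v (smooth_cst U _) mean_curvature_smooth Up)); rewrite vder_cst mul0r add0r.
  by congr (_ * _); exact: (vder_sum _ _ oU (fun l => shape_smooth l l) Up).
apply: (etrans (vderM v (smooth_cst U _) (shape_smooth k i) Up)).
by rewrite vder_cst mul0r add0r mulN1r.
Qed.

Lemma vder_div_tensor p i k : U p ->
  dot (vder (fun x => theta iota x (e i x *m A x)) p (e i p)) (t k p) =
  vder (div_coef i k) p (e i p) + \sum_j div_coef i j p * G i j k p.
Proof.
move=> Up.
have sAt j : smooth_on U (fun q => div_coef i j q * dot (t j q) (t k p)).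
  exact: (smoothM oU (div_coef_smooth i j) (smooth_dot oU (frame_image_smooth j) (smooth_cst U _))).
rewrite -(vder_dot_cst _ _ (theta_smooth emb oU (div_tensor_field_smooth i)) Up).
rewrite (vder_congr (g := fun q => \sum_j div_coef i j q * dot (t j q) (t k p)) _ oU Up); last first.
  move=> q Uq; rewrite div_tensor_expand// dot_suml; apply: eq_bigr => j _.
  by rewrite dotZl.
rewrite (vder_sum _ _ oU sAt Up).
transitivity (\sum_j (vder (div_coef i j) p (e i p) * (j == k)%:R + div_coef i j p * G i j k p)).
  apply: eq_bigr => j _.
  rewrite (vderM _ (div_coef_smooth i j) (smooth_dot oU (frame_image_smooth j) (smooth_cst U _)) Up).
  by rewrite (vder_dot_cst _ _ (frame_image_smooth j) Up) (frame_gram Up).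
rewrite big_split /=; congr (_ + _).
exact: (sum_mul_delta (fun j => vder (div_coef i j) p (e i p))).
Qed.

Lemma divergence_coords p k : U p ->
  \sum_i (vder (div_coef i k) p (e i p) + \sum_j div_coef i j p * G i j k p
     - \sum_j G i i j p * div_coef j k p) = 0.
Proof.
move=> Up; have E := div0 oU fe Up.
have := congr1 (fun v => dot (theta iota p v) (t k p)) E.
rewrite theta0 dot0l theta_sum// dot_suml => E2; rewrite -[RHS]E2; apply: eq_bigr => i _.
rewrite /nabla_tensor thetaB// dotBl; congr (_ - _).
  by rewrite -(vder_div_tensor i k Up); apply: esym; exact: dot_nabla (div_tensor_field_smooth i) Up.
rewrite nablaE// mulmx_suml theta_sum// dot_suml.
apply: eq_bigr => j _; rewrite -scalemxAl thetaZ// dotZl.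
by congr (_ * _); rewrite -div_tensor_coefE.
Qed.

(** [laplacian_height] for the actual hypersurface: the divergence condition enters
    through [divergence_coords] and [divergence_algebra]. *)
Lemma height_laplacian V p : U p ->
  \sum_i (vder (fun q => vder (fun z => dot (nu z) V) q (e i q)) p (e i p)
    - \sum_j G i i j p * vder (fun z => dot (nu z) V) p (e j p)) =
  - dot (nu p) V * \sum_i \sum_j (h i j p) ^+ 2.
Proof.
move=> Up.
have ntU q : U q -> forall i, dot (nu q) (t i q) = 0 by move=> _ i; exact: gauss_orthogonal.
apply: (laplacian_height oU se frame_image_smooth gauss_smooth_on frame_gram ntU
  (fun q _ => gauss_unit q) V Up).
apply: (@divergence_algebra _ _ (fun i j => h i j p) (fun i j k => G i j k p)
  (fun i j k => vder (h j k) p (e i p))).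
- by move=> i j k; exact: (connection_antisym e oU frame_image_smooth frame_gram).
- move=> i j k.
  exact: (codazzi oU se frame_image_smooth gauss_smooth_on frame_gram ntU
    (fun q _ => gauss_unit q) k Up (bracketE i j Up)).
move=> k; rewrite -[RHS](divergence_coords k Up); apply: eq_bigr => i _.
by rewrite vder_div_coef.
Qed.

End Geometry.

(** * Strong maximum principle *)

Section Tools.
Variables (R : realType) (n : nat).
Implicit Types (U B : set 'rV[R]_n).

Lemma closed_setI_preimage (B : set 'rV[R]_n) (C : set R) (f : 'rV[R]_n -> R) :
  closed B -> closed C -> (forall x, B x -> {for x, continuous f}) ->
  closed (B `&` f @^-1` C).
Proof.
move=> cB cC cf z clz.
have Bz : B z by apply: cB; move=> V /clz [y [[By _] Vy]]; exists y.
split=> //; apply: cC => V nV.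
have [y [[By Cy] Vy]] := clz _ (cf z Bz _ nV).
by exists (f y).
Qed.

Lemma ball_compact (x : 'rV[R]_n) (r : R) : compact [set y | `|x - y| <= r].
Proof.
apply: bounded_closed_compact; last exact: closed_closed_ball_.
exists (`|x| + r); split; first exact: num_real.
move=> M hM y /= hy; apply: le_trans (ltW hM).
rewrite -[y](subKr x); apply: le_trans (ler_normB _ _) _.
by rewrite lerD2l.
Qed.

Lemma compact_attains_max (B : set 'rV[R]_n) (f : 'rV[R]_n -> R) : B !=set0 -> compact B ->
  (forall x, B x -> {for x, continuous f}) ->
  exists2 c, B c & forall z, B z -> f z <= f c.
Proof.
move=> B0 cB cf.
have cw : {within B, continuous f}.
  by apply: continuous_in_subspaceT => x; rewrite inE => /cf.
have [c] := compact_EVT_max B0 cB cw; rewrite inE => Bc h.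
by exists c => // z Bz; apply: h; rewrite inE.
Qed.

(** The norm of row vectors is the sup norm. *)
Lemma norm_dot (w : 'rV[R]_n) : `|w| ^+ 2 <= dot w w.
Proof.
have [->|w0] := eqVneq w 0; first by rewrite normr0 expr0n dot0l.
have [i E] := mx_norm_neq0 (x := w) (contra_neq (@mx_norm_eq0 _ _ _ w) w0).
rewrite {1}/Num.norm /= E -normrX ger0_norm ?sqr_ge0//.
rewrite /dot (bigD1 i.2)//= (ord1 i.1) expr2 lerDl.
by apply: sumr_ge0 => j _; rewrite -expr2 sqr_ge0.
Qed.

(** Restriction to the line through [x] in the direction [v].  If the second derivative
    were positive, the first would be positive just after [x], and [w] would increase. *)
Lemma second_derivative_test U (w : 'rV[R]_n -> R) x v : open U -> Ck 2 U w -> U x ->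
  (\forall y \near x, w y <= w x) -> 'D_v w x = 0 /\ 'D_v ('D_v w) x <= 0.
Proof.
move=> oU [dw cw] Ux wx; have [dv _] := cw v.
have nU : nbhs x U by exact: open_nbhs_nbhs.
have lc : (fun s : R => x + s *: v) @ (0 : R) --> x.
  rewrite -[X in _ --> X]addr0 -(scale0r v); apply: cvgD; first exact: cvg_cst.
  exact: scalel_continuous.
have near0 : \forall s \near (0 : R), U (x + s *: v) /\ w (x + s *: v) <= w x.
  exact: (lc _ (filterI nU wx)).
have [d d0 Hd] : exists2 d : R, 0 < d & forall s, `|s| <= d ->
    U (x + s *: v) /\ w (x + s *: v) <= w x.
  move/nbhs_normP : near0 => [d /= d0 Hd]; exists (d / 2); first by rewrite divr_gt0.
  move=> s sd; apply: Hd; rewrite /= sub0r normrN; apply: le_lt_trans sd _.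
  by rewrite ltr_pdivrMr// ltr_pMr// ltr1n.
have x0 : x + 0 *: v = x by rewrite scale0r addr0.
have D0 : 'D_v w x = 0.
  have d1 : is_derive (0 : R) (1 : R) (fun s => w (x + s *: v)) ('D_v w x).
    by rewrite -{2}x0; apply: is_derive_line; rewrite x0; exact: dw.
  have itvP (s : R) : s \in `]-d, d[ -> `|s| <= d.
    by rewrite in_itv /= -ltr_norml => /ltW.
  have d2 : is_derive (0 : R) (1 : R) (fun s => w (x + s *: v)) 0.
    apply: (@derive1_at_max _ _ (- d) d).
    - by rewrite ge0_cp// ltW.
    - move=> s /itvP /Hd [Us _].
      by have [] := @is_derive_line _ _ w x v s (dw _ Us).
    - by rewrite in_itv/= oppr_lt0 d0.
    - by move=> s /itvP /Hd [_]; rewrite x0.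
  by rewrite -(@derive_val _ _ _ _ _ _ _ d1) (@derive_val _ _ _ _ _ _ _ d2).
split=> //; rewrite leNgt; apply/negP => c0.
set c := 'D_v ('D_v w) x in c0.
have d1 : is_derive (0 : R) (1 : R) (fun s => 'D_v w (x + s *: v)) c.
  by rewrite /c -{2}x0; apply: is_derive_line; rewrite x0; exact: dv.
have : (fun s : R => s^-1 *: ('D_v w (x + (s *: 1 + 0) *: v) - 'D_v w (x + 0 *: v))) @ 0^' --> c.
  by have [cv <-] := d1; exact: cv.
rewrite x0 D0 => /cvgrPdist_lt /(_ _ c0).
move=> /(nbhs_normP (0:R)) [d' /= d'0 Hd'].
pose s := Num.min d (d' / 2).
have s0 : 0 < s by rewrite lt_min d0 divr_gt0.
have sd : s <= d by rewrite ge_min lexx.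
have sd' : s < d'.
  by rewrite gt_min; apply/orP; right; rewrite ltr_pdivrMr// ltr_pMr// ltr1n.
have [|xi /andP[xi0 xis] E] := @mvt_line _ _ w x v s s0.
  move=> r /andP[r0 rs]; apply: dw; have [|//] := Hd r _.
  by rewrite ger0_norm// (le_trans rs).
have [_ le1] : U (x + s *: v) /\ w (x + s *: v) <= w x by apply: Hd; rewrite gtr0_norm.
have := Hd' xi; rewrite /= sub0r normrN gtr0_norm// => /(_ (lt_trans xis sd')).
rewrite gt_eqF// => /(_ isT).
rewrite subr0 addr0 -[xi *: 1]/(xi * 1) mulr1 => close.
have Dpos : 0 < 'D_v w (x + xi *: v).
  move: close; set D := 'D_v w _; rewrite -[xi^-1 *: D]/(xi^-1 * D) => close.
  have : 0 < xi^-1 * D by move: close; rewrite ltr_norml => /andP[_]; lra.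
  by rewrite pmulr_rgt0// invr_gt0.
have : 0 < w (x + s *: v) - w x by rewrite E mulr_gt0.
by rewrite subr_gt0 ltNge le1.
Qed.

End Tools.

Lemma affine_Ck (R : realType) (n : nat) k (U : set 'rV[R]_n) (c : R) (a b : 'rV[R]_n) :
  Ck k U (fun z => c *: (z - a) + b).
Proof.
have da z : differentiable (fun z : 'rV[R]_n => z - a) z by apply: differentiableB.
have dz z : differentiable (fun z : 'rV[R]_n => c *: (z - a)) z by apply: differentiableZ.
have df z : differentiable (fun z : 'rV[R]_n => c *: (z - a) + b) z by apply: differentiableD.
case: k => [x _|k]; first exact: differentiable_continuous.
split=> [x _ //|v].
have -> : 'D_v (fun z : 'rV[R]_n => c *: (z - a) + b) = (fun=> c *: v).
  apply/funext => z.
  rewrite (@deriveD _ _ _ (fun z : 'rV[R]_n => c *: (z - a)) (cst b)); last 2 first.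
  - exact: diff_derivable.
  - exact: derivable_cst.
  rewrite derive_cst addr0 (@deriveZ _ _ _ (fun z : 'rV[R]_n => z - a)); last exact: diff_derivable.
  by rewrite deriveB//= derive_id derive_cst subr0.
exact: Ck_cst.
Qed.

Lemma derive_addZ (R : realType) (V : normedModType R) (f g : V -> R) (c : R) (x v : V) :
  differentiable f x -> differentiable g x ->
  'D_v (fun z => f z + c * g z) x = 'D_v f x + c * 'D_v g x.
Proof.
move=> /(diff_derivable (v := v)) df /(diff_derivable (v := v)) dg.
have dcg : derivable (c *: (g : V -> R)) x v by exact: derivableZ.
by apply: (etrans (deriveD df dcg)); rewrite deriveZ.
Qed.

Lemma derive_mul (R : realType) (V : normedModType R) (f g : V -> R) (x v : V) :
  differentiable f x -> differentiable g x ->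
  'D_v (fun z => f z * g z) x = f x * 'D_v g x + g x * 'D_v f x.
Proof. by move=> df dg; apply: deriveM; exact: diff_derivable. Qed.

Section Barrier.
Variables (R : realType) (n : nat) (z0 b : 'rV[R]_n) (K : R).
Implicit Types (z w : 'rV[R]_n).

(** The power of [z] with respect to the sphere that passes through [z0] and has the
    diameter $[z_0 - b, z_0]$. *)
Definition tangent_sphere z : R := dot (z - z0) (z - z0) + dot (z - z0) b.

(** Positive inside the sphere, negative just outside; for large [K] the quadratic term
    dominates the second derivative transversally to the sphere. *)
Definition hopf_barrier z : R :=
  - tangent_sphere z + K * (tangent_sphere z * tangent_sphere z).
Notation s := tangent_sphere.

Let l w z := dot (2 *: (z - z0) + b) w.

Let shift_Ck k : Ck k setT (fun z => z - z0).
Proof.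
apply: (Ck_congr openT _ (affine_Ck k setT 1 z0 0)) => z _.
by rewrite scale1r addr0.
Qed.

Let shift_diff z : differentiable (fun z => z - z0) z.
Proof. by have [h _] := shift_Ck 1; exact: h. Qed.

Let derive_shift z w : 'D_w (fun z => z - z0) z = w.
Proof. by rewrite deriveB//= derive_id derive_cst subr0. Qed.

Lemma tangent_sphere_Ck k : Ck k setT s.
Proof.
have c1 := shift_Ck k.
exact: (CkD openT (Ck_dot openT c1 c1) (Ck_dot openT c1 (Ck_cst k setT b))).
Qed.

Lemma hopf_barrier_Ck k : Ck k setT hopf_barrier.
Proof.
have c1 := tangent_sphere_Ck k.
have c2 := CkD openT (CkM openT (Ck_cst k setT (-1 : R)) c1)
  (CkM openT (Ck_cst k setT K) (CkM openT c1 c1)).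
by apply: (Ck_congr openT _ c2) => z _; rewrite mulN1r.
Qed.

Let sphere_diff z : differentiable s z.
Proof. by have [h _] := tangent_sphere_Ck 1; exact: h. Qed.

Let l_diff w z : differentiable (l w) z.
Proof.
have [h _] := Ck_dot openT (affine_Ck 1 setT 2 z0 b) (Ck_cst 1 setT w).
exact: h.
Qed.

Lemma derive_tangent_sphere z w : 'D_w s z = l w z.
Proof.
have d1 : differentiable (fun z => dot (z - z0) (z - z0)) z.
  by have [h _] := Ck_dot openT (shift_Ck 1) (shift_Ck 1); exact: h.
have d2 : differentiable (fun z => dot (z - z0) b) z.
  by have [h _] := Ck_dot openT (shift_Ck 1) (Ck_cst 1 setT b); exact: h.
apply: (etrans (deriveD (diff_derivable (v := w) d1) (diff_derivable (v := w) d2))).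
rewrite (derive_dot _ (shift_diff z) (shift_diff z)).
rewrite (derive_dot _ (shift_diff z) (differentiable_cst b z)) !derive_shift.
rewrite derive_cst dot0r addr0 /l [RHS]dotDl dotZl (dotC w (z - z0)) (dotC w (cst b z)).
by congr (_ + _); ring.
Qed.

Let derive_l z w : 'D_w (l w) z = 2 * dot w w.
Proof.
have dz : differentiable (fun z => 2 *: (z - z0) + b) z.
  by have [h _] := affine_Ck 1 setT 2 z0 b; exact: h.
rewrite /l (derive_dot _ dz (differentiable_cst w z)) derive_cst dot0r addr0.
have d1 := diff_derivable (v := w) (shift_diff z).
have -> : 'D_w (fun z => 2 *: (z - z0) + b) z = 2 *: w.
  rewrite (@deriveD _ _ _ (fun z => 2 *: (z - z0)) (cst b)).
  - by rewrite derive_cst addr0 (@deriveZ _ _ _ (fun z => z - z0))// derive_shift.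
  - exact: derivableZ.
  - exact: derivable_cst.
exact: dotZl.
Qed.

Lemma derive_barrier z w : 'D_w hopf_barrier z = (2 * K * s z - 1) * l w z.
Proof.
have ds := sphere_diff z.
have dN : differentiable (fun z => - s z) z by exact: differentiableN.
have dM : differentiable (fun z => s z * s z) z by exact: differentiableM.
apply: (etrans (derive_addZ K w dN dM)).
have -> : 'D_w (fun z => - s z) z = - 'D_w s z by apply: deriveN; exact: diff_derivable.
rewrite (derive_mul w ds ds) derive_tangent_sphere.
by move: (l w z) (s z) => L S; ring.
Qed.

Lemma derive2_barrier z w : 'D_w ('D_w hopf_barrier) z =
  2 * K * (l w z) ^+ 2 + (2 * K * s z - 1) * (2 * dot w w).
Proof.
have -> : 'D_w hopf_barrier = (fun z => (-1 + 2 * K * s z) * l w z).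
  by apply/funext => y; rewrite derive_barrier [-1 + _]addrC.
have d1 : differentiable (cst (-1 : R)) z by exact: differentiable_cst.
have ds : differentiable (fun y => -1 + 2 * K * s y) z.
  have [h _] := CkD openT (Ck_cst 1 setT (-1 : R))
    (CkM openT (Ck_cst 1 setT (2 * K)) (tangent_sphere_Ck 1)).
  exact: h.
apply: (etrans (derive_mul w ds (l_diff w z))).
rewrite (derive_addZ (2 * K) w d1 (sphere_diff z)) derive_cst derive_tangent_sphere derive_l.
by move: (l w z) (s z) (dot w w) => L S D; ring.
Qed.

End Barrier.

Section Hopf.
Variables (R : realType) (n k : nat) (O : set 'rV[R]_n).
Variables (eps : 'I_k -> 'rV[R]_n -> 'rV[R]_n) (beta : 'rV[R]_n -> 'rV[R]_n).
Variables (u : 'rV[R]_n -> R) (m : R).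
Hypothesis oO : open O.
Hypothesis ceps : forall i, Ck 0 O (eps i).
Hypothesis cbeta : Ck 0 O beta.
Hypothesis elliptic : forall x w, O x -> w != 0 -> exists i, dot w (eps i x) != 0.
Hypothesis cu : Ck 2 O u.
Hypothesis um : forall x, O x -> u x <= m.

Definition elliptic_op (f : 'rV[R]_n -> R) x : R :=
  \sum_i 'D_(eps i x) ('D_(eps i x) f) x + 'D_(beta x) f x.

Hypothesis subsol : forall x, O x -> 0 <= elliptic_op u x.

Lemma elliptic_op_barrier z0 b K z : elliptic_op (hopf_barrier z0 b K) z =
  \sum_i (2 * K * (dot (2 *: (z - z0) + b) (eps i z)) ^+ 2
     + (2 * K * tangent_sphere z0 b z - 1) * (2 * dot (eps i z) (eps i z)))
  + (2 * K * tangent_sphere z0 b z - 1) * dot (2 *: (z - z0) + b) (beta z).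
Proof.
rewrite /elliptic_op derive_barrier; congr (_ + _).
by apply: eq_bigr => i _; rewrite derive2_barrier.
Qed.

Lemma tangent_sphere0 (z0 b : 'rV[R]_n) : tangent_sphere z0 b z0 = 0.
Proof. by rewrite /tangent_sphere subrr !dot0l addr0. Qed.

Lemma elliptic_op_barrier_cont z0 b K x : O x ->
  {for x, continuous (elliptic_op (hopf_barrier z0 b K))}.
Proof.
move=> Ox.
have cs : Ck 0 O (tangent_sphere z0 b) by exact: (Ck_sub (@subsetT _ O) (tangent_sphere_Ck z0 b 0)).
have cl (X : 'rV[R]_n -> 'rV[R]_n) : Ck 0 O X -> Ck 0 O (fun z => dot (2 *: (z - z0) + b) (X z)).
  by move=> cX; apply: (Ck_dot oO _ cX); exact: affine_Ck.
have c2 := CkD oO (CkM oO (Ck_cst 0 O (2 * K)) cs) (Ck_cst 0 O (-1 : R)).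
have c3 : Ck 0 O (fun z => \sum_i (2 * K * (dot (2 *: (z - z0) + b) (eps i z)
      * dot (2 *: (z - z0) + b) (eps i z))
     + (2 * K * tangent_sphere z0 b z - 1) * (2 * dot (eps i z) (eps i z)))
  + (2 * K * tangent_sphere z0 b z - 1) * dot (2 *: (z - z0) + b) (beta z)).
  apply: CkD => //; last exact: (CkM oO c2 (cl _ cbeta)).
  apply: Ck_sum => // i.
  have ci := cl _ (@ceps i).
  exact: (CkD oO (CkM oO (Ck_cst 0 O (2 * K)) (CkM oO ci ci))
     (CkM oO c2 (CkM oO (Ck_cst 0 O (2 : R)) (Ck_dot oO (@ceps i) (@ceps i))))).
by apply: (Ck_congr oO _ c3) => // z Oz; rewrite elliptic_op_barrier.
Qed.

(** At [z0], [tangent_sphere] vanishes and has gradient [b], so that the value of the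
    operator is affine in [K] with slope twice the sum of the $(b . eps_i)^2$, which is
    positive by ellipticity. *)
Lemma barrier_exists z0 b : O z0 -> b != 0 ->
  exists2 K, 0 < K & 0 < elliptic_op (hopf_barrier z0 b K) z0.
Proof.
move=> Oz b0.
pose S := \sum_i (dot b (eps i z0)) ^+ 2.
pose T := \sum_i 2 * dot (eps i z0) (eps i z0) + dot b (beta z0).
have S0 : 0 < S.
  have [i hi] := elliptic Oz b0.
  rewrite /S (bigD1 i)//= ltr_wpDr ?exprn_even_gt0//.
  by apply: sumr_ge0 => j _; exact: sqr_ge0.
(* The value of the operator is [2 * K * S - T]. *)
exists ((`|T| + 1) / (2 * S)).
  by rewrite divr_gt0 ?mulr_gt0// ltr_wpDl.
rewrite elliptic_op_barrier tangent_sphere0 subrr scaler0 add0r mulr0 sub0r.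
rewrite big_split /= -mulr_sumr -mulr_sumr mulN1r mulN1r -/S.
have -> : 2 * ((`|T| + 1) / (2 * S)) * S = `|T| + 1 by field; rewrite gt_eqF.
have -> (c : R) : c + - \sum_i 2 * dot (eps i z0) (eps i z0) - dot b (beta z0) = c - T.
  by rewrite /T opprD addrA.
have := ler_norm T; lra.
Qed.

Lemma elliptic_op_max (f : 'rV[R]_n -> R) x : Ck 2 O f -> O x -> (\forall y \near x, f y <= f x) ->
  elliptic_op f x <= 0.
Proof.
move=> cf Ox fx; rewrite /elliptic_op.
rewrite (second_derivative_test (beta x) oO cf Ox fx).1 addr0.
by apply: sumr_le0 => i _; have [] := second_derivative_test (eps i x) oO cf Ox fx.
Qed.

Lemma elliptic_opD (f g : 'rV[R]_n -> R) (c : R) x : Ck 2 O f -> Ck 2 O g -> O x ->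
  elliptic_op (fun z => f z + c * g z) x = elliptic_op f x + c * elliptic_op g x.
Proof.
move=> cf cg Ox.
have nO : nbhs x O by exact: open_nbhs_nbhs.
have gen (S S1 S2 a b : R) : S = S1 + c * S2 ->
    S + (a + c * b) = S1 + a + c * (S2 + b) by move=> ->; ring.
case: cf cg => [df cf] [dg cg].
rewrite /elliptic_op (derive_addZ _ _ (df _ Ox) (dg _ Ox)); apply: gen.
rewrite mulr_sumr -big_split /=; apply: eq_bigr => i _.
have [d1 _] := cf (eps i x); have [d2 _] := cg (eps i x).
rewrite -(derive_addZ _ _ (d1 _ Ox) (d2 _ Ox)).
by apply: near_eq_derive; apply: filterS nO => y Oy; exact: derive_addZ (df _ Oy) (dg _ Oy).
Qed.

(** The last hypothesis says that the points [z] near [z0] with [u z = m] lie outside the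
    ball with center [z0 - b] and radius $|b|$.  The sphere of [tangent_sphere] is
    internally tangent to it at [z0], so those points, except [z0], have positive power
    and negative barrier.  Adding a small multiple of the barrier to [u] then leaves the
    values on a small sphere around [z0] at most [m], the value at [z0]; so the sum has
    an interior maximum, where the operator cannot be positive, although it is positive
    on the barrier and nonnegative on [u]. *)
Lemma hopf_touching (z0 b : 'rV[R]_n) (r : R) : b != 0 -> 0 < r -> u z0 = m ->
  (forall z : 'rV[R]_n, `|z0 - z| <= r -> O z) ->
  (forall z : 'rV[R]_n, `|z0 - z| <= r -> u z = m ->
    0 <= dot (z - z0) (z - z0) + 2 * dot (z - z0) b) ->
  False.
Proof.
move=> b0 r0 uz0 rO touch.
have Oz0 : O z0 by apply: rO; rewrite subrr normr0 ltW.
have nO : nbhs z0 O by exact: open_nbhs_nbhs.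
have [K K0 LK] := barrier_exists Oz0 b0.
pose v := hopf_barrier z0 b K; pose s := tangent_sphere z0 b.
have cs : continuous s by move=> z; exact: (tangent_sphere_Ck z0 b 0).
have cv : continuous v by move=> z; exact: (hopf_barrier_Ck z0 b K 0).
have v0 : v z0 = 0 by rewrite /v /hopf_barrier tangent_sphere0 !mulr0 addr0 oppr0.
have N1 : \forall z \near z0, 0 < elliptic_op v z.
  exact: (elliptic_op_barrier_cont Oz0 (lt_nbhsr LK)).
have N2 : \forall z \near z0, s z < K^-1.
  have : s z0 < K^-1 by rewrite /s tangent_sphere0 invr_gt0.
  by move=> h; exact: (cs z0 _ (lt_nbhsl h)).
have [r1 r10 Hr1] : exists2 r1 : R, 0 < r1 & forall z, `|z0 - z| <= r1 ->
    [/\ `|z0 - z| <= r, 0 < elliptic_op v z & s z < K^-1].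
  have : \forall z \near z0, 0 < elliptic_op v z /\ s z < K^-1 by exact: filterI.
  move=> /nbhs_normP[d /= d0 Hd]; exists (Num.min r (d / 2)).
    by rewrite lt_min r0 divr_gt0.
  move=> z; rewrite le_min => /andP[zr zd].
  have [] // : 0 < elliptic_op v z /\ s z < K^-1.
  apply: Hd => /=; apply: le_lt_trans zd _.
  by rewrite ltr_pdivrMr// ltr_pMr// ltr1n.
pose B := [set z | `|z0 - z| <= r1].
have cB : compact B := @ball_compact R n z0 r1.
have BO z : B z -> O z by move=> /Hr1 [/rO].
have cuB z : B z -> {for z, continuous u}.
  by move=> /BO; exact: (CkS (CkS cu)).
have clB : closed B := @closed_closed_ball_ R _ z0 r1.
pose S := B `&` [set z | `|z0 - z| = r1].
have vneg z : S z -> u z = m -> v z < 0.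
  move=> [Bz Sz] uz; have [zr _ sz] := Hr1 _ Bz.
  have := touch _ zr uz => h.
  have az : z - z0 != 0.
    apply/eqP => az; move: Sz; rewrite /= -opprB az oppr0 normr0 => E.
    by rewrite -E ltxx in r10.
  have a0 := dot_gt0 az.
  have s0 : 0 < s z by rewrite /s /tangent_sphere; lra.
  have -> : v z = s z * (K * s z - 1).
    by rewrite /v /hopf_barrier -/(s z); move: (s z) => t; ring.
  rewrite pmulr_rlt0// subr_lt0 mulrC -ltr_pdivlMr// div1r.
  exact: sz.
(* [S'] is the part of the sphere where the barrier is nonnegative; there [u] stays
   away from [m]. *)
have [ep ep0 Hep] : exists2 ep : R, 0 < ep & forall z, S z -> u z + ep * v z <= m.
  pose S' := S `&` v @^-1` [set t | 0 <= t].
  have clS : closed S.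
    apply: (closed_setI_preimage (f := fun z => `|z0 - z|) clB (@closed_eq _ r1)) => z _.
    have /differentiable_continuous h : differentiable (fun y : 'rV[R]_n => z0 - y) z.
      exact: differentiableB.
    exact: (cvg_norm h).
  have clS' : closed S' by apply: closed_setI_preimage (clS) (@closed_ge _ 0) _ => z _; exact: cv.
  have cS' : compact S' by apply: subclosed_compact clS' cB _ => z [[]].
  have [S'0|/set0P/negP] := pselect (S' !=set0); last first.
    rewrite negbK => /eqP S'0; exists 1 => // z Sz; rewrite mul1r.
    have uz := um (BO _ Sz.1).
    have : v z < 0.
      by rewrite ltNge; apply/negP => vz; have : S' z by []; rewrite S'0.
    lra.
  have cuS' z : S' z -> {for z, continuous u} by move=> [[/cuB]].
  have [c S'c Hc] := compact_attains_max S'0 cS' cuS'.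
  have [c' S'c' Hc'] := compact_attains_max S'0 cS' (fun z _ => cv z).
  have uc : u c < m.
    rewrite lt_neqAle (um (BO _ S'c.1.1)) andbT; apply/eqP => uc.
    by have := vneg _ S'c.1 uc; rewrite ltNge (S'c.2 : 0 <= v c).
  have vc' : 0 <= v c' := S'c'.2.
  (* On [S'] the sum is at most [u c + ep * v c'], elsewhere on the sphere [v] is
     negative. *)
  exists ((m - u c) / (1 + v c')).
    by rewrite divr_gt0 ?subr_gt0// ltr_wpDr.
  move=> z Sz; have uz := um (BO _ Sz.1).
  have ep0 : 0 < (m - u c) / (1 + v c') by rewrite divr_gt0 ?subr_gt0// ltr_wpDr.
  have [vz|vz] := leP 0 (v z); last first.
    by have := pmulr_rlt0 (v z) ep0; rewrite vz => /idP; lra.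
  have S'z : S' z by [].
  have h1 := Hc _ S'z; have h2 := Hc' _ S'z.
  have : (m - u c) / (1 + v c') * v z <= m - u c.
    rewrite mulrAC ler_pdivrMr ?ltr_wpDr//; apply: ler_wpM2l; first by rewrite subr_ge0 ltW.
    by lra.
  lra.
pose w z := u z + ep * v z.
have cw : Ck 2 O w.
  have cvO : Ck 2 O v by exact: (Ck_sub (@subsetT _ O) (hopf_barrier_Ck z0 b K 2)).
  exact: (CkD oO cu (CkM oO (Ck_cst 2 O ep) cvO)).
have Bz0 : B z0 by rewrite /B /= subrr normr0 ltW.
have [p0 Bp0 Hp0] := compact_attains_max (ex_intro _ z0 Bz0) cB (fun z Bz => CkS (CkS cw) z (BO z Bz)).
(* If the maximum is attained on the boundary, it is [m] and is attained at [z0] too. *)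
have [p Bp Hp] : exists2 p, `|z0 - p| < r1 & forall z, B z -> w z <= w p.
  have [E|ne] := eqVneq `|z0 - p0| r1.
    exists z0; first by rewrite subrr normr0.
    move=> z /Hp0 h; apply: (le_trans h); rewrite {2}/w v0 mulr0 addr0 uz0.
    exact: Hep.
  by exists p0 => //; rewrite lt_neqAle ne.
have Op : O p by apply: BO; exact: ltW.
have Np : \forall y \near p, w y <= w p.
  apply/nbhs_normP; exists (r1 - `|z0 - p|) => /=; first by rewrite subr_gt0.
  move=> y /= py; apply: Hp; rewrite /B /=.
  have -> : z0 - y = (z0 - p) + (p - y) by rewrite addrA subrK.
  apply: le_trans (ler_normD _ _) _; lra.
have := elliptic_op_max cw Op Np; rewrite leNgt => /negP; apply.
have cvO : Ck 2 O v by exact: (Ck_sub (@subsetT _ O) (hopf_barrier_Ck z0 b K 2)).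
rewrite (elliptic_opD ep cu cvO Op) ltr_wpDl ?subsol// mulr_gt0//.
by have [] := Hr1 p (ltW Bp).
Qed.

(** Hopf's strong maximum principle.  If [u] is not constant near [x], there is [y] close
    to [x] with [u y < m]; the ball around [y] that first meets the set where [u = m]
    touches it at a point [z0], contrary to [hopf_touching]. *)
Lemma strong_maximum x : O x -> u x = m -> \forall y \near x, u y = m.
Proof.
move=> Ox ux.
have /nbhs_normP[r' /= r'0 Hr'] : nbhs x O by exact: open_nbhs_nbhs.
pose r := r' / 2; have r0 : 0 < r by rewrite divr_gt0.
have rO z : `|x - z| <= r -> O z.
  move=> h; apply: Hr' => /=; apply: le_lt_trans h _.
  by rewrite ltr_pdivrMr// ltr_pMr// ltr1n.
have [//|nn] := pselect (\forall y \near x, u y = m); exfalso.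
have cd : Ck 0 setT (fun y : 'rV[R]_n => dot (y - x) (y - x)).
  by apply: Ck_dot; [exact: openT|..]; (apply: CkD; [exact: openT|exact: Ck_id|exact: Ck_cst]).
have cdx : {for x, continuous (fun y : 'rV[R]_n => dot (y - x) (y - x))} by exact: cd.
(* With [y] at Euclidean distance less than [r / 2] from [x], the contact point nearest
   to [y] is at distance less than [r] from [x]. *)
have [y [yx uy]] : exists y : 'rV[R]_n, dot (y - x) (y - x) < (r / 2) ^+ 2 /\ u y <> m.
  apply: contra_notP nn => h.
  have N : \forall y \near x, dot (y - x) (y - x) < (r / 2) ^+ 2.
    have h0 : dot (x - x) (x - x) < (r / 2) ^+ 2.
      by rewrite subrr dot0l exprn_gt0// divr_gt0.
    exact: (cdx _ (lt_nbhsl h0)).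
  apply: filterS N => y yx; have [//|uy] := pselect (u y = m).
  by case: h; exists y.
have small w : dot w w < (r / 2) ^+ 2 -> `|w| < r / 2.
  move=> h; have := le_lt_trans (norm_dot w) h.
  by rewrite ltr_pXn2r// nnegrE ?divr_ge0// ltW.
pose Z := [set z | `|x - z| <= r] `&` u @^-1` [set m].
have cZ : compact Z.
  apply: subclosed_compact (@ball_compact R n x r) _; last by move=> z [].
  apply: closed_setI_preimage; first exact: closed_closed_ball_.
    exact: closed_eq.
  by move=> z /rO; exact: (CkS (CkS cu)).
have Zx : Z x by split => //=; rewrite subrr normr0 ltW.
have cg : Ck 0 setT (fun z : 'rV[R]_n => - dot (z - y) (z - y)).
  have c1 : Ck 0 setT (fun z : 'rV[R]_n => dot (z - y) (z - y)).
    by apply: Ck_dot; [exact: openT|..]; (apply: CkD; [exact: openT|exact: Ck_id|exact: Ck_cst]).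
  apply: (Ck_congr openT _ (CkM openT (Ck_cst 0 setT (-1 : R)) c1)) => z _.
  by rewrite mulN1r.
have [z0 Zz0 Hz0] := compact_attains_max (ex_intro _ x Zx) cZ (fun z _ => cg z I).
have dz0 : dot (z0 - y) (z0 - y) < (r / 2) ^+ 2.
  apply: le_lt_trans yx; have := Hz0 _ Zx; rewrite lerN2.
  by rewrite -(opprB y x) dotNl dotNr opprK.
have xz0 : `|x - z0| < r.
  have -> : x - z0 = - (y - x) - (z0 - y) by rewrite opprB opprB addrA subrK.
  apply: le_lt_trans (ler_normB _ _) _; rewrite normrN [r]splitr.
  by apply: ltrD; exact: small.
apply: (@hopf_touching z0 (z0 - y) (r - `|x - z0|)).
- by apply/eqP => /subr0_eq E; apply: uy; rewrite -E; exact: Zz0.2.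
- by rewrite subr_gt0.
- exact: Zz0.2.
- move=> z hz; apply: rO; have -> : x - z = (x - z0) + (z0 - z) by rewrite addrA subrK.
  by apply: le_trans (ler_normD _ _) _; lra.
move=> z hz uz.
have Zz : Z z.
  split => //=; have -> : x - z = (x - z0) + (z0 - z) by rewrite addrA subrK.
  by apply: le_trans (ler_normD _ _) _; lra.
have := Hz0 _ Zz; rewrite lerN2.
have -> : z - y = (z - z0) + (z0 - y) by rewrite addrA subrK.
move: (z - z0) (z0 - y) => a c; rewrite dotDl !dotDr (dotC c a); lra.
Qed.

End Hopf.

(** * Height functions on a closed hypersurface *)

Section HeightConstant.
Variables (R : realType) (n : nat) (Mt : weitzenbock R n.+1) (M : smoothManifold R n).
Variables (o : orientation M) (iota : M -> Mt) (N : M -> 'rV[R]_n.+1) (W : M -> 'M[R]_n).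
Hypothesis M_connected : connected [set: M].
Hypothesis M_closed : compact [set: M].
Hypothesis emb : smooth_embedding iota.
Hypothesis N_normal : is_unit_normal iota o N.
Hypothesis wein : is_weingarten iota N W.
Hypothesis tf : torsion_free iota.
Hypothesis div0 : divergence_free iota
      (fun p => (\tr (W p))%:M + 2 *: antisym_part iota W p).
Let nu := gauss_map iota N.
Variable V : 'rV[R]_n.+1.
Let u p := dot (nu p) V.

(** The squared norm of the Weingarten map. *)
Definition norm_second_form (e : 'I_n -> M -> 'rV[R]_n) p : R :=
  \sum_i \sum_j (second_form e (fun i q => theta iota q (e i q)) nu i j p) ^+ 2.

Hypothesis subharmonic : forall c e, orthonormal_frame iota (chdom c) e ->
  forall p, chdom c p -> 0 <= - u p * norm_second_form e p.

(** The strong maximum principle in the chart of index [q].  The operator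
    $f |-> \sum_i e_i (e_i f) - (nabla_{e_i} e_i) f$ becomes there the operator with
    principal part given by the components [eps i] of the [e i] and with first order
    part [beta]. *)
Lemma height_max_open (m : R) : (forall p, u p <= m) -> open [set p | u p = m].
Proof.
move=> um; rewrite openE => q /= uq; rewrite /interior.
have qq := chdom_center q; have oc := chdom_open q.
have [e fe] := gram_schmidt emb q.
have se i : smooth_field (chdom q) (e i) by case: fe.
have su : smooth_on setT u.
  exact: (smooth_dot openT (gauss_smooth N_normal) (smooth_cst setT V)).
have suq : smooth_on (chdom q) u by exact: smooth_sub su.
pose O := chart q @` (chdom q `&` chdom q).
have oO : open O by exact: chart_image_open.
pose eps i := field_in_chart (e i) q \o chinv q.
pose G := connection_form e (fun i p => theta iota p (e i p)).
have ceps i k : Ck k O (eps i) := field_coo q (se i) k.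
(* The derivatives of the [eps i] come from [derive_along_field]. *)
pose beta x := \sum_i ('D_(eps i x) (eps i) x + \sum_j - G i i j (chinv q x) *: eps j x).
have cbeta : Ck 0 O beta.
  apply: (Ck_sum _ oO) => i; apply: (CkD oO).
    exact: (Ck_derive_row oO (ceps i 0%N) (ceps i 1%N)).
  apply: (Ck_sum _ oO) => j; apply: (Ck_scale_row oO _ (ceps j 0%N)).
  have sG : smooth_on (chdom q) (fun p => - G i i j p).
    exact: (smoothN oc (smooth_connection_form oc se (frame_image_smooth emb oc fe) i i j)).
  exact: sG q 0%N.
have ell x w : O x -> w != 0 -> exists i, dot w (eps i x) != 0.
  move=> [z [qz _] <-] w0; apply: contra_notP (negP w0) => h.
  (* The tangent vector at [z] whose components in the chart [q] are [w]. *)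
  pose v := \sum_a w ord0 a *: coord_field q a z.
  have df := chart_diff (chdom_center z) qz.
  have vsum (I : Type) (r : seq I) (F : I -> 'rV[R]_n) (a : I -> R) :
      vder (chart q) z (\sum_(i <- r) a i *: F i) = \sum_(i <- r) a i *: vder (chart q) z (F i).
    rewrite /vder deriveE// linear_sum; apply: eq_bigr => i _.
    by rewrite linearZ deriveE.
  have Ev : vder (chart q) z v = w.
    rewrite vsum [RHS]row_sum_delta; apply: eq_bigr => a _; congr (_ *: _).
    exact: coord_field_id.
  apply/eqP/dot_eq0; rewrite -{2}Ev (theta_expand emb (frame_gram fe qz) v) vsum dot_sumr.
  rewrite big1// => i _; rewrite dotZr.
  have -> : dot w (vder (chart q) z (e i z)) = 0.
    apply/eqP; have [//|ne] := boolP (_ == _); exfalso; apply: h; exists i.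
    by rewrite /eps /= chartK.
  by rewrite mulr0.
have cu2 : Ck 2 O (u \o chinv q) := suq q 2%N.
have um' x : O x -> (u \o chinv q) x <= m by move=> _; exact: um.
have sub x : O x -> 0 <= elliptic_op eps beta (u \o chinv q) x.
  move=> [z [qz _] <-].
  have -> : elliptic_op eps beta (u \o chinv q) (chart q z) =
    \sum_i (vder (fun q => vder u q (e i q)) z (e i z) - \sum_j G i i j z * vder u z (e j z)).
    have Eeps i : eps i (chart q z) = vder (chart q) z (e i z) by rewrite /eps /= chartK.
    have dz := smooth_diff suq qz qz.
    have bE : 'D_(beta (chart q z)) (u \o chinv q) (chart q z) =
       \sum_i ('D_('D_(eps i (chart q z)) (eps i) (chart q z)) (u \o chinv q) (chart q z)
         - \sum_j G i i j z * 'D_(eps j (chart q z)) (u \o chinv q) (chart q z)).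
      rewrite (deriveE _ dz) /beta linear_sum; apply: eq_bigr => i _.
      rewrite linearD (deriveE _ dz); congr (_ + _).
      rewrite linear_sum -sumrN; apply: eq_bigr => j _.
      by rewrite linearZ (deriveE _ dz) /= (chartK qz) -mulNr.
    have key i w : w = vder (chart q) z (e i z) ->
        vder (fun q => vder u q (e i q)) z (e i z) =
        'D_('D_w (eps i) (chart q z)) (u \o chinv q) (chart q z) +
        'D_w ('D_w (u \o chinv q)) (chart q z).
      by move=> ->; exact: (vder2_chart (e i z) oc suq (se i) qz qz).
    have gen (a b c c' t : R) : t = b + a -> c = c' -> a + (b - c) = t - c'.
      by move=> -> ->; rewrite addrA [a + b]addrC.
    rewrite /elliptic_op bE -big_split; apply: eq_bigr => i _.
    apply: (gen _ _ _ _ _ (key i _ (Eeps i))); apply: eq_bigr => j _; congr (_ * _).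
    by rewrite (Eeps j); apply: esym; exact: (vder_chart _ qz dz).
  rewrite (height_laplacian emb N_normal wein tf div0 oc fe V qz).
  exact: subharmonic fe z qz.
have Oq : O (chart q q) by exists q.
have := strong_maximum oO (fun i => @ceps i 0%N) cbeta ell cu2 um' sub Oq.
rewrite /= (chartK qq) => /(_ uq) near1.
have N1 : \forall p \near q, u (chinv q (chart q p)) = m.
  exact: (chart_continuous qq near1).
have N2 : nbhs q (chdom q) by apply: open_nbhs_nbhs.
by apply: filterS2 N1 N2 => p + qp; rewrite chartK.
Qed.

(** By compactness the height has a maximum; the set where it is attained is closed,
    open by [height_max_open], and [M] is connected. *)
Lemma height_constant p q : u p = u q.
Proof.
have su : smooth_on setT u.
  exact: (smooth_dot openT (gauss_smooth N_normal) (smooth_cst setT V)).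
have cu := smooth_continuous su.
have [pm _ Hm] := @compact_EVT_max _ _ u [set: M] (ex_intro _ p I) M_closed
  (continuous_subspaceT cu).
suff E : [set z | u z = u pm] = [set: M].
  have Ep : [set z | u z = u pm] p by rewrite E.
  have Eq : [set z | u z = u pm] q by rewrite E.
  by rewrite Ep Eq.
apply: M_connected; first by exists pm.
- exists [set z | u z = u pm]; last by rewrite setTI.
  by apply: height_max_open => z; apply: Hm; rewrite inE.
- exists [set z | u z = u pm]; last by rewrite setTI.
  apply: (@closed_comp _ _ u [set a | a = u pm]); last exact: closed_eq.
  by move=> z _; exact: cu.
Qed.

End HeightConstant.

Theorem theorem3p25 (R : realType) (n : nat) (n_gt0 : (0 < n)%N)
    (Mt : weitzenbock R n.+1) (M : smoothManifold R n) (o : orientation M)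
    (iota : M -> Mt) (N : M -> 'rV[R]_n.+1) (W : M -> 'M[R]_n)
    (M_connected : connected [set: M]) (M_closed : compact [set: M])
    (iota_embedding : smooth_embedding iota)
    (N_normal : is_unit_normal iota o N)
    (W_weingarten : is_weingarten iota N W)
    (M_torsion_free : torsion_free iota)
    (div0 : divergence_free iota
      (fun p => (\tr (W p))%:M + 2 *: antisym_part iota W p)) :
  (exists2 V : 'rV[R]_n.+1, sphere V &
     range (gauss_map iota N) `<=` closed_hemisphere V) <->
  (exists2 V : 'rV[R]_n.+1, sphere V &
     range (gauss_map iota N) `<=` equator V).
Proof.
split=> -[V sV hV]; last first.
  by exists V => // x /hV [sx /= Vx]; split => //=; rewrite Vx.
have [[p0 _]|M0] := pselect ([set: M] !=set0); last first.
  by exists V => // x [p _ _]; exfalso; apply: M0; exists p.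
set nu := gauss_map iota N in hV *.
have unit p : sphere (nu p) := gauss_unit N_normal p.
have hp p : dot (nu p) V <= 0.
  by rewrite dotC; have [] := hV (nu p) (ex_intro2 _ _ p I erefl).
have nsf0 e p : 0 <= norm_second_form iota N e p.
  by apply: sumr_ge0 => i _; apply: sumr_ge0 => j _; exact: sqr_ge0.
have uc p q : dot (nu p) V = dot (nu q) V.
  apply: (height_constant M_connected M_closed iota_embedding N_normal W_weingarten
    M_torsion_free div0) => c e fe z cz.
  by rewrite mulr_ge0// oppr_ge0; exact: hp.
have [u0|u0] := eqVneq (dot (nu p0) V) 0.
  exists V => // _ [p _ <-]; split; first exact: unit.
  by rewrite /= dotC (uc p p0).
have nsf c e p : orthonormal_frame iota (chdom c) e -> chdom c p ->
    norm_second_form iota N e p = 0.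
  move=> fe cp.
  have := height_laplacian iota_embedding N_normal W_weingarten M_torsion_free div0
    (chdom_open c) fe V cp.
  have -> : (fun z => dot (gauss_map iota N z) V) = (fun=> dot (nu p0) V).
    by apply/funext => z; exact: uc.
  rewrite big1 => [|i _]; last first.
    rewrite [X in _ - X]big1 => [|j _]; last by rewrite vder_cst mulr0.
    rewrite subr0; have -> : (fun q => vder (fun _ : M => dot (nu p0) V) q (e i q)) = (fun=> 0).
      by apply/funext => q; exact: vder_cst.
    exact: vder_cst.
  move=> /esym/eqP; rewrite mulf_eq0 oppr_eq0 (uc p p0) (negPf u0) => /eqP; exact.
have [e fe] := gram_schmidt iota_embedding p0.
pose i0 := Ordinal n_gt0.
(* Heights in every direction are constant now; a tangent direction at [p0] has height 0
   there. *)
pose V' := theta iota p0 (e i0 p0).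
exists V'; first by rewrite /sphere /= /V' (frame_gram fe (chdom_center p0)) eqxx.
move=> _ [p _ <-]; split; first exact: unit.
rewrite /= dotC.
have -> : dot (nu p) V' = dot (nu p0) V'.
  apply: (height_constant M_connected M_closed iota_embedding N_normal W_weingarten
    M_torsion_free div0) => c e' fe' z cz.
  by rewrite (nsf c) // mulr0.
exact: gauss_orthogonal N_normal p0 (e i0 p0).
Qed.
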